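(* Let $\epsilon>0$ be a constant and let $p=\frac{1+\epsilon}{d}$. Then with high probability (i.e. with probability tending to one as $d\to\infty$) the random graph $Q^d_p$ contains a cycle of length $\Omega\left(\frac{2^d}{d^3(\log d)^3}\right)$.
   Context: $Q^d$ denotes the $d$-dimensional hypercube: vertex set $\{0,1\}^d$, two vertices adjacent iff they differ in exactly one coordinate. $Q^d_p$ denotes the random subgraph of $Q^d$ on the same vertex set obtained by retaining each edge of $Q^d$ independently with probability $p$. All asymptotics are as $d\to\infty$; implicit constants may depend on $\epsilon$. *)

(* Defs.v *)
From HB Require Import structures.
From mathcomp Require Import all_boot all_order all_algebra.
From mathcomp Require Import boolp reals exp.
Set Implicit Arguments. Unset Strict Implicit. Unset Printing Implicit Defensive.
Import Order.TTheory GRing.Theory Num.Theory.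
Local Open Scope ring_scope.

Notation hvert d := {ffun 'I_d -> bool}.

Definition hadj (d : nat) (x y : hvert d) : bool :=
  #|[set i : 'I_d | x i != y i]| == 1%N.

Definition hedges (d : nat) : {set {set hvert d}} :=
  [set e : {set hvert d} | [exists x : hvert d, exists y : hvert d,
                                 hadj x y && (e == [set x; y])]].

(* Probability (under Q^d_p: each edge kept independently with prob. p) that
   the random spanning subgraph, given by its edge set G, satisfies P. *)
Definition hprob (R : realType) (d : nat) (p : R)
    (P : {set {set hvert d}} -> Prop) : R :=
  \sum_(G in powerset (hedges d) | `[< P G >])
     p ^+ #|G| * (1 - p) ^+ (#|hedges d| - #|G|).

Definition has_cycle_ge (R : realType) (d : nat) (G : {set {set hvert d}})
    (L : R) : Prop :=
  exists s : seq (hvert d),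
    [/\ (3 <= size s)%N, uniq s,
        cycle (fun x y => [set x; y] \in G) s & L <= (size s)%:R].

(* Main.v *)
Require Import Defs.
From HB Require Import structures.
From mathcomp Require Import all_boot all_order all_algebra.
From mathcomp Require Import boolp reals sequences exp.
From mathcomp Require Import zify ring lra.
Import Order.TTheory GRing.Theory Num.Theory.
Local Open Scope ring_scope.
Set Implicit Arguments. Unset Strict Implicit. Unset Printing Implicit Defensive.

(** Write [n = 2 ^ d] and expose the edges in three rounds, of densities
    [(1 + eps / 3) / d], [eps / (3 d)] and [eps / (3 d)].

    After the first round, a vertex lies with probability bounded below in a
    component of order at least [K = C d], and disjoint subcubes make these events
    independent for linearly many neighbours of a given vertex. So, with high
    probability, all but [n / d ^ 2] vertices have linearly many neighbours in the
    set [W] of vertices of such components. Cut [W] into connected pieces of order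
    between [K] and [(d + 2) K].

    Fix a set [U] of at most [m = c n / d ^ 3] vertices and a 2-colouring of the
    pieces avoiding [U], with both classes of linear order in [n]. By isoperimetry,
    linearly many edges of the cube join a vertex with many neighbours in one class
    to a vertex with many neighbours in the other. The last two rounds therefore
    fail to join the classes outside [U] with probability only [exp (- c' n / d)],
    which beats the [2 ^ (n / K)] colourings and the few choices of [U] when [C] is
    large. Hence no [m] vertices separate [W] in a balanced way: for every such [U]
    some component of [G - U] contains more than half of [W]. A graph with this
    property has a cycle of length more than [m]. *)

(** * Expectation over a Bernoulli random subset *)

(** The exponent 3 comes from isoperimetry. Two classes of order [n] are only guaranteed about [n]
    cube edges between them, although degrees are [d]; so at most a small multiple of [n / d]
    vertices may stay out of both sides. Each vertex of [U] can spoil one piece, and the cutting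
    bounds a piece only by [(d + 2) * K]. Keeping [m * (d + 2) * K] below a small multiple of
    [n / d] with [K = C d] gives [m] of order [n / d ^ 3]. The last two rounds are separate because
    they have different tasks: one opens edges between the two neighbourhoods, the other attaches
    the ends of these edges to the classes. A vertex with order [d] neighbours in a class is
    attached with probability bounded below at density of order [1 / d], so each crossing edge
    succeeds with probability of order [1 / d]. The attachments of different vertices use disjoint
    edge sets, which replaces a search for a matching by a one-edge-at-a-time recursion. The first
    round is held fixed meanwhile, so [W] and its pieces are deterministic in the union bound. *)

Section BernoulliSubset.
Variables (R : realFieldType) (T : finType).
Implicit Types (p q c : R) (E F G : {set T}) (f g : {set T} -> R) (e : T).

(** Probabilities are treated as expectations of indicators [b%:R], so that Markov and union bounds
    become manipulations of sums; [hprobE] translates [hprob]. *)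
Definition EX p E f : R :=
  \sum_(G in powerset E) p ^+ #|G| * (1 - p) ^+ (#|E| - #|G|) * f G.

Lemma eq_EX p E f g :
  (forall G, G \subset E -> f G = g G) -> EX p E f = EX p E g.
Proof.
by move=> fg; apply: eq_bigr => G; rewrite powersetE => GE; rewrite fg.
Qed.

Lemma EX_set0 p f : EX p set0 f = f set0.
Proof.
by rewrite /EX powerset0 big_set1 cards0 subnn !expr0 !mul1r.
Qed.

(** Conditioning on one element. With [setU1_ind] it drives the inductions on the ground set;
    [explore] and [no_crossing_prob] use it to expose a single edge. *)
Lemma EX_setU1 p e E f : e \notin E ->
  EX p (e |: E) f =
  p * EX p E (fun G => f (e |: G)) + (1 - p) * EX p E f.
Proof.
move=> eE; rewrite /EX (bigID (fun G : {set T} => e \in G)) /=; congr (_ + _).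
  rewrite mulr_sumr [LHS](reindex_onto (fun G => e |: G) (fun G => G :\ e)) /=; last first.
    by move=> G /andP[_ eG]; rewrite setD1K.
  apply: eq_big => [G|G].
    rewrite !powersetE setU11 andbT; apply/andP/idP => [[sGE /eqP<-]|sGE].
      by rewrite subDset.
    split; first exact: setUS.
    rewrite setU1K //; apply: contra eE; exact: (subsetP sGE).
  rewrite !powersetE => /andP[/andP[sGE _] /eqP eG].
  have eNG : e \notin G by rewrite -eG !inE eqxx.
  by rewrite !cardsU1 eE eNG !add1n subSS exprS; ring.
rewrite mulr_sumr; apply: eq_big => [G|G].
  rewrite !powersetE; apply/andP/idP => [[sGE eG]|sGE].
    by rewrite -(setU1K eE) subsetD1 sGE.
  split; first by apply: subset_trans sGE (subsetUr _ _).
  by apply: contra eE; exact: (subsetP sGE).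
rewrite powersetE => /andP[sGE eG].
have {}sGE : G \subset E by rewrite -(setU1K eE) subsetD1 sGE.
by rewrite cardsU1 eE add1n subSn ?subset_leq_card // exprS; ring.
Qed.

Lemma setU1_ind (P : {set T} -> Prop) :
  P set0 -> (forall e E, e \notin E -> P E -> P (e |: E)) -> forall E, P E.
Proof.
move=> P0 PU E; have [k] := ubnP #|E|; elim: k E => // k IH E ltEk.
have [->//|[e eE]] := set_0Vmem E.
rewrite -(setD1K eE); apply: PU; first by rewrite !inE eqxx.
by apply: IH; rewrite (cardsD1 e E) eE in ltEk.
Qed.

Lemma EX_cst p E c : EX p E (fun=> c) = c.
Proof.
elim/setU1_ind: E => [|e E eE IH]; first by rewrite EX_set0.
by rewrite EX_setU1 // IH; ring.
Qed.

Lemma EXD p E f g : EX p E (fun G => f G + g G) = EX p E f + EX p E g.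
Proof. by rewrite -big_split; apply: eq_bigr => G _; rewrite mulrDr. Qed.

Lemma EXZ p E c f : EX p E (fun G => c * f G) = c * EX p E f.
Proof. by rewrite mulr_sumr; apply: eq_bigr => G _; ring. Qed.

Lemma EX_sum (I : Type) (r : seq I) (P : pred I) p E (F : I -> {set T} -> R) :
  EX p E (fun G => \sum_(i <- r | P i) F i G) = \sum_(i <- r | P i) EX p E (F i).
Proof.
by rewrite exchange_big; apply: eq_bigr => G _; rewrite mulr_sumr.
Qed.

Lemma EX_split p E F f : [disjoint E & F] ->
  EX p (E :|: F) f = EX p E (fun G => EX p F (fun H => f (G :|: H))).
Proof.
elim/setU1_ind: E f => [|e E eE IH] f.
  by rewrite EX_set0 set0U => _; apply: eq_EX => G _; rewrite set0U.
rewrite disjoints_subset subUset sub1set inE => /andP[eF sEF].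
rewrite -setUA EX_setU1 ?inE ?(negPf eE) // EX_setU1 //.
rewrite !IH ?disjoints_subset //.
by congr (_ * _ + _); apply: eq_EX => G _; apply: eq_EX => H _; rewrite setUA.
Qed.

Lemma EX_restrict p E F f : F \subset E -> (forall G, f G = f (G :&: F)) ->
  EX p E f = EX p F f.
Proof.
move=> sFE fF; rewrite -{1}(setID E F) (setIidPr sFE) EX_split; last first.
  by rewrite -setI_eq0 setIDA setIC setDIl setDv setI0.
apply: eq_EX => G sGF; rewrite -[RHS](EX_cst p (E :\: F)); apply: eq_EX => H sH.
rewrite fF setIUl; have -> : H :&: F = set0.
  by apply/eqP; rewrite setI_eq0 disjoints_subset (subset_trans sH) ?subsetDr.
by rewrite setU0 -fF.
Qed.

Lemma EX_indep p E F f g : 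
  (forall G, f G = f (G :&: F)) -> (forall G, g G = g (G :\: F)) ->
  EX p E (fun G => f G * g G) = EX p E f * EX p E g.
Proof.
move=> fF gF.
have dis : [disjoint E :&: F & E :\: F].
  by rewrite -setI_eq0 setIDA setIAC setIid setDIl setDv setI0.
have E1 (G H : {set T}) : G \subset E :&: F -> H \subset E :\: F -> f (G :|: H) = f G.
  move=> sG sH; rewrite fF setIUl; suff -> : H :&: F = set0 by rewrite setU0 -fF.
  by apply/eqP; rewrite setI_eq0 disjoints_subset (subset_trans sH) ?subsetDr.
have E2 (G H : {set T}) : G \subset E :&: F -> H \subset E :\: F -> g (G :|: H) = g H.
  move=> sG sH; rewrite gF setDUl; suff -> : G :\: F = set0 by rewrite set0U -gF.
  by apply/eqP; rewrite setD_eq0 (subset_trans sG) ?subsetIr.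
rewrite -(setID E F) !EX_split //.
transitivity (EX p (E :&: F) (fun G => EX p (E :\: F) g * f G)).
  apply: eq_EX => G sG; rewrite mulrC -EXZ; apply: eq_EX => H sH.
  by rewrite E1 ?E2.
rewrite EXZ mulrC; congr (_ * _).
  by apply: eq_EX => G sG; rewrite -[LHS](EX_cst p (E :\: F)); apply: eq_EX => H sH; rewrite E1.
rewrite -[LHS](EX_cst p (E :&: F)); apply: eq_EX => G sG; apply: eq_EX => H sH.
by rewrite E2.
Qed.

(** An element misses the union of two independent rounds with probability [(1 - p) * (1 - q)]; this
    is checked one element at a time. *)
Lemma EX_sprinkle p q E f :
  EX (1 - (1 - p) * (1 - q)) E f =
  EX p E (fun G => EX q E (fun H => f (G :|: H))).
Proof.
elim/setU1_ind: E f => [|e E eE IH] f; first by rewrite !EX_set0 setU0.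
rewrite !EX_setU1 // !IH.
under [X in _ = p * X + _]eq_EX => G _.
  rewrite EX_setU1 //.
  under eq_EX => H _ do rewrite -setUUr.
  under [X in (1 - q) * X]eq_EX => H _ do rewrite -setUA.
  rewrite -mulrDl addrC subrK mul1r.
over.
under [X in _ = _ + (1 - p) * X]eq_EX => G _.
  rewrite EX_setU1 //.
  under [X in q * X]eq_EX => H _ do rewrite setUCA.
over.
rewrite /= EXD !EXZ; ring.
Qed.

Section Order.
Variable p : R.
Hypotheses (p_ge0 : 0 <= p) (p_le1 : p <= 1).

Lemma le_EX E f g :
  (forall G, G \subset E -> f G <= g G) -> EX p E f <= EX p E g.
Proof.
move=> fg; apply: ler_sum => G; rewrite powersetE => GE.
by apply: ler_wpM2l (fg _ GE); rewrite mulr_ge0 ?exprn_ge0 ?subr_ge0.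
Qed.

Lemma EX_ge0 E f : (forall G, G \subset E -> 0 <= f G) -> 0 <= EX p E f.
Proof. by move=> f0; rewrite -(EX_cst p E 0); exact: le_EX. Qed.

End Order.

(** Coupling: density [q] is obtained from [p] by sprinkling a second round of density
    [(q - p) / (1 - p)], which only enlarges the set. *)
Lemma EX_mono p q E f : 0 <= p <= q -> q <= 1 ->
  (forall G H : {set T}, G \subset H -> H \subset E -> f G <= f H) -> 
  EX p E f <= EX q E f.
Proof.
move=> /andP[p0 pq] q1 fmono.
have [p1|p1] := ltP p 1; last by have -> : p = q by lra.
have np : 1 - p != 0 by lra.
set r := (q - p) / (1 - p).
have r0 : 0 <= r by rewrite divr_ge0; lra.
have r1 : r <= 1 by rewrite ler_pdivrMr; lra.
have -> : q = 1 - (1 - p) * (1 - r) by rewrite /r; field.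
rewrite EX_sprinkle; apply: le_EX => //; first exact: ltW.
move=> G sGE; rewrite -[X in X <= _](EX_cst r E); apply: le_EX => // H sHE.
by apply: fmono; rewrite ?subsetUl // subUset sGE.
Qed.

End BernoulliSubset.

(** * Long cycles from havens *)

Section Components.
Local Open Scope nat_scope.
Variable V : finType.
Implicit Types (G H : {set {set V}}) (X Y S U W : {set V}) (x y z w : V).

Definition adj G : rel V := fun x y => [set x; y] \in G.
Definition adj_in G X : rel V := fun x y => [&& x \in X, y \in X & adj G x y].
(** For [x] outside [X] this is the singleton of [x], since [adj_in] wants both ends in [X]. *)
Definition component G X x : {set V} := [set y | connect (adj_in G X) x y].

Lemma adj_sym G : symmetric (adj G).
Proof. by move=> x y; rewrite /adj setUC. Qed.

Lemma adj_in_sym G X : symmetric (adj_in G X).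
Proof. by move=> x y; rewrite /adj_in adj_sym andbCA. Qed.

Lemma component_refl G X x : x \in component G X x.
Proof. by rewrite inE connect0. Qed.

Lemma component_sym G X x y : (y \in component G X x) = (x \in component G X y).
Proof. by rewrite !inE (sym_connect_sym (@adj_in_sym G X)). Qed.

Lemma component_eq G X x y : y \in component G X x -> component G X y = component G X x.
Proof.
rewrite inE => xy; apply/setP => z; rewrite !inE.
by rewrite (same_connect (sym_connect_sym (@adj_in_sym G X)) xy).
Qed.

Lemma component_min G X S x : x \in S ->
  (forall y z, y \in S -> adj_in G X y z -> z \in S) -> component G X x \subset S.
Proof.
move=> xS clS; apply/subsetP => y; rewrite inE => /connectP[p].
elim: p x xS => [|z p IH] x xS /= => [_ -> //|/andP[xz pz] Ey].
by apply: (IH z) => //; apply: clS xz.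
Qed.

Lemma component_sub G X x : x \in X -> component G X x \subset X.
Proof. by move=> xX; apply: component_min => // y z _ /and3P[]. Qed.

Lemma component_adj G X x y z : y \in component G X x -> adj_in G X y z -> z \in component G X x.
Proof. by rewrite !inE => xy yz; apply: connect_trans xy (connect1 yz). Qed.

Lemma componentS G H X Y x : G \subset H -> X \subset Y ->
  component G X x \subset component H Y x.
Proof.
move=> sGH sXY; apply: component_min; first exact: component_refl.
move=> y z xy /and3P[yX zX yz]; apply: component_adj xy _.
by rewrite /adj_in !(subsetP sXY) //=; apply: (subsetP sGH).
Qed.

(** Otherwise the component of [z] after deletion of [w] would be closed in [X] and would have to
    contain [w]. *)
Lemma component_last_step G X w z : w \in X -> z \in component G X w -> z != w ->
  exists w', [/\ w' \in X :\ w, w' \in component G (X :\ w) z & adj G w' w].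
Proof.
move=> wX zw nzw; have zX : z \in X by apply: (subsetP (component_sub G wX)).
case: (boolP [exists w', (w' \in component G (X :\ w) z) && adj G w' w]) => [/existsP[w' /andP[zw' w'w]]|].
  by exists w'; split=> //; apply: (subsetP (component_sub G _)) zw'; rewrite !inE nzw.
move=> /existsPn noadj; have : w \in component G X z by rewrite component_sym.
have/subsetP/[apply] : component G X z \subset component G (X :\ w) z.
  apply: component_min; first exact: component_refl.
  move=> a b za /and3P[aX bX ab]; apply: component_adj (za) _; rewrite /adj_in !inE aX bX ab.
  have -> : a != w.
    by have: a \in X :\ w; [apply: (subsetP (component_sub G _)) za; rewrite !inE nzw|rewrite !inE; case/andP].
  rewrite !andbT /=; apply: contraNneq (noadj a) => eb; by rewrite za -eb.
move=> wz; have : w \in X :\ w by apply: (subsetP (component_sub G _)) wz; rewrite !inE nzw.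
by rewrite !inE eqxx.
Qed.

(* The haven always points to the component of [G - P] next to the head [w] of
   the path [w :: P]; if no cycle is longer than [m], this component sees only
   the [m - 1] most recent vertices of [P], so the path can be extended. *)
Lemma haven_step G W m P w : 1 < m ->
  (forall U, #|U| <= m -> exists2 x, x \notin U &
     #|W| < 2 * #|W :&: component G (~: U) x|) ->
  uniq (w :: P) -> path (adj G) w P ->
  #|W| < 2 * #|W :&: component G (~: [set x in P]) w| ->
  (exists s, [/\ m < size s, uniq s & cycle (adj G) s]) \/
  exists w', [/\ uniq [:: w', w & P], path (adj G) w' (w :: P) &
    #|W| < 2 * #|W :&: component G (~: [set x in w :: P]) w'|].
Proof.
move=> m1 haven uwP pwP Bbig; set B := component G _ w in Bbig.
have /= /andP[wP uP] := uwP.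
have BP : B \subset ~: [set x in P] by apply: component_sub; rewrite !inE.
case: (boolP [exists u, [exists x, [&& u \in drop m.-1 P, x \in B & adj G u x]]]).
  move=> /existsP[u /existsP[x /and3P[uD xB ux]]]; left.
  have defP : P = take m.-1 P ++ drop m.-1 P by rewrite cat_take_drop.
  have szP : m.-1 <= size P.
    by rewrite leqNgt; apply/negP => /ltnW/drop_oversize E; rewrite E in uD.
  have szT : size (take m.-1 P) = m.-1 by rewrite size_takel.
  have [D1 [D2 defD]] : exists D1 D2, drop m.-1 P = D1 ++ u :: D2.
    by case/splitPr: uD => D1 D2; exists D1, D2.
  set P1 := take m.-1 P ++ D1.
  have {}defP : P = rcons P1 u ++ D2 by rewrite cat_rcons /P1 -catA -defD.
  have : w \in component G (~: [set x in P]) x by rewrite component_sym.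
  rewrite inE => /connectP[q0 pq0 lastq0].
  case/shortenP: pq0 lastq0 => q pq uq _ lastq {q0}.
  have qP : {subset x :: q <= ~: [set x in P]}.
    move=> z; rewrite inE => /predU1P[->|]; first exact: (subsetP BP).
    elim: q x {uq lastq xB ux} pq => //= a q IH x /andP[/and3P[_ aP _] pa].
    by rewrite inE => /predU1P[->//|]; apply: IH pa.
  (* The cycle goes from [x] to [w] inside [B], back along [P] to [u], and closes by the edge from
     [u] to [x]. The [m - 1] vertices of [take m.-1 P] together with [u] and [x] already exceed
     [m]. *)
  exists (x :: q ++ rcons P1 u); split.
  - by rewrite /= size_cat size_rcons /P1 size_cat szT; lia.
  - rewrite -cat_cons cat_uniq uq /=; move: uP; rewrite {1}defP cat_uniq => /and3P[-> _ _].
    rewrite andbT; apply/hasPn => z zP1; apply/negP => /qP; rewrite !inE defP.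
    by rewrite mem_cat zP1.
  - rewrite /= -cats1 -catA cat_path; apply/andP; split.
      by apply: sub_path pq => a b /and3P[].
    rewrite -lastq cats1 rcons_path last_rcons ux andbT.
    by move: pwP; rewrite {1}defP cat_path => /andP[].
move=> /existsPn noadj; right.
(* The haven is asked only about [w] and the [m - 1] most recent vertices of [P]. Its component [C]
   meets [B], because each of them holds more than half of [W]. *)
set U := [set x in w :: take m.-1 P].
have cardU : #|U| <= m.
  by rewrite cardsE (leq_trans (card_size _)) //= size_take; case: ifP; lia.
have [y yU Cbig] := haven U cardU; set C := component G _ y in Cbig.
have [z /setIP[zB zC]] : exists z, z \in B :&: C.
  apply/set0Pn; apply/negP => /eqP BC0.
  have := subset_leq_card (subsetIl W (B :|: C)).
  by rewrite setIUr cardsU -setIIr BC0 setI0 cards0; lia.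
have CU : C \subset ~: U by apply: component_sub; rewrite inE.
have nzw : z != w.
  by have := subsetP CU z zC; rewrite !inE negb_or => /andP[].
have XE : ~: [set x in P] :\ w = ~: [set x in w :: P].
  by apply/setP => a; rewrite !inE negb_or.
have zX : z \in ~: [set x in w :: P].
  by rewrite -XE !inE nzw; have := subsetP BP z zB; rewrite !inE.
have wX : w \in ~: [set x in P] by rewrite !inE.
have [w' []] := component_last_step wX zB nzw; rewrite XE => w'X w'z w'w.
have SB : component G (~: [set x in w :: P]) z \subset B.
  by rewrite /B -(component_eq zB); apply: componentS => //; rewrite -XE subsetDl.
(* [C] avoids only the recent part of [P] by definition; it also avoids the old part, since it is
   explored from [z] inside [B] and no old vertex has a neighbour in [B]. *)
have CS : C \subset component G (~: [set x in w :: P]) z.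
  rewrite /C -(component_eq zC); apply: component_min => [|a b aS /and3P[_ bU ab]].
    exact: component_refl.
  apply: component_adj (aS) _; rewrite /adj_in ab (subsetP (component_sub G zX)) //= andbT.
  move: bU; rewrite !inE !negb_or => /andP[-> bT] /=; apply/negP => bP.
  have /existsPn/(_ a) := noadj b; rewrite (subsetP SB) // adj_sym ab !andbT.
  by move: bP; rewrite -{1}(cat_take_drop m.-1 P) mem_cat (negPf bT) => /= ->.
exists w'; split.
- by move: w'X; rewrite [uniq _]/= -/(uniq (w :: P)) uwP andbT !inE.
- by rewrite /= w'w.
- rewrite (component_eq w'z); apply: leq_trans Cbig _.
  by rewrite leq_mul2l subset_leq_card // setIS.
Qed.

(** A path cannot have more than [#|V|] vertices, so extending it from a single vertex by
    [haven_step] must end with a cycle. *)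
Lemma haven_cycle G W m : 1 < m ->
  (forall U, #|U| <= m -> exists2 x, x \notin U &
     #|W| < 2 * #|W :&: component G (~: U) x|) ->
  exists s, [/\ m < size s, uniq s & cycle (adj G) s].
Proof.
move=> m1 haven.
have ext k P w : #|V| - size P <= k -> uniq (w :: P) -> path (adj G) w P ->
    #|W| < 2 * #|W :&: component G (~: [set x in P]) w| ->
    exists s, [/\ m < size s, uniq s & cycle (adj G) s].
  elim: k P w => [|k IH] P w szP uP pP big.
    move: szP; rewrite leqn0 subn_eq0 leqNgt => /negP[].
    by rewrite -[X in X <= _](card_uniqP uP) max_card.
  have [//|[w' [uP' pP' big']]] := haven_step m1 haven uP pP big.
  by apply: (IH (w :: P) w') => //=; rewrite subnS -subn1 leq_subLR add1n.
have U0 : #|@set0 V| <= m by rewrite cards0.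
have [x _ xbig] := haven _ U0.
apply: (ext _ [::] x (leqnn _)) => //.
Qed.
End Components.

(** * Cutting components into connected pieces *)

Section Pieces.
Local Open Scope nat_scope.
Variables (V : finType) (G : {set {set V}}) (d : nat).
Hypothesis deg_le : forall x, #|[set y | adj G x y]| <= d.
Implicit Types (C D S : {set V}) (x y z : V).

(** The empty set does not count as connected. *)
Definition connected S := [exists x in S, S \subset component G S x].

Lemma connected_component S x : connected S -> x \in S -> component G S x = S.
Proof.
move=> /existsP[y /andP[yS sS]] xS; apply/eqP; rewrite eqEsubset component_sub //=.
by rewrite (component_eq (subsetP sS _ xS)).
Qed.

Lemma component_connected C x : x \in C -> connected (component G C x).
Proof.
move=> xC; apply/existsP; exists x; rewrite component_refl /=.
apply/subsetP => y xy; have : y \in component G (component G C x) x :&: component G C x.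
  apply: (subsetP _ _ xy); apply: component_min; first by rewrite inE !component_refl.
  move=> a b /setIP[aI aC] ab; have bC := component_adj aC ab.
  rewrite inE bC andbT; apply: component_adj aI _.
  by rewrite /adj_in aC bC; case/and3P: ab.
by case/setIP.
Qed.

Lemma component_avoid C D y : (forall z, z \in component G C y -> z \notin D) ->
  component G C y \subset component G (C :\: D) y.
Proof.
move=> av; have : component G C y \subset component G (C :\: D) y :&: component G C y.
  apply: component_min; first by rewrite inE !component_refl.
  move=> a b /setIP[aI aC] ab; have bC := component_adj aC ab.
  rewrite inE bC andbT; apply: component_adj aI _.
  by case/and3P: ab => aC' bC' ab; rewrite /adj_in !in_setD !av // aC' bC'.
by move/subset_trans; apply; apply: subsetIl.
Qed.

(** Pigeonhole: every branch of [C] at [y] contains a neighbour of [y], and there are at most [d] of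
    those. *)
Lemma big_branch C y K : connected C -> y \in C -> d * K < #|C :\ y| ->
  exists2 z, z \in C :\ y & K <= #|component G (C :\ y) z|.
Proof.
move=> cC yC big; set N := [set z in C :\ y | adj G y z].
case: (boolP [exists z in N, K <= #|component G (C :\ y) z|]).
  by move=> /existsP[z /andP[/setIdP[zC _] zK]]; exists z.
move=> /existsPn small; exfalso; move: big; apply/negP; rewrite -leqNgt.
have sub : C :\ y \subset \bigcup_(z in N) component G (C :\ y) z.
  apply/subsetP => a /setD1P[ay aC].
  have ya : a \in component G C y by rewrite (connected_component cC).
  have [w [wC aw wy]] := component_last_step yC ya ay.
  by apply/bigcupP; exists w; rewrite 1?component_sym // inE wC adj_sym.
apply: leq_trans (subset_leq_card sub) _.
have h : #|\bigcup_(z in N) component G (C :\ y) z| <= \sum_(z in N) #|component G (C :\ y) z|.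
  apply: (big_ind2 (fun (A : {set V}) n => #|A| <= n)) => [|A1 n1 A2 n2 h1 h2|//].
    by rewrite cards0.
  exact: leq_trans (leq_card_setU A1 A2) (leq_add h1 h2).
apply: leq_trans h _; apply: (@leq_trans (\sum_(z in N) K)).
  apply: leq_sum => z zN; have := small z; rewrite zN /= -ltnNge; exact: ltnW.
rewrite sum_nat_const leq_mul2r; apply/orP; right.
apply: leq_trans (subset_leq_card _) (deg_le y).
by apply/subsetP => z; rewrite !inE => /andP[].
Qed.

Lemma component_detach C y z : connected C -> y \in C ->
  let C2 := component G (C :\ y) z in y \notin C2 ->
  C :\: C2 \subset component G (C :\: C2) y.
Proof.
move=> cC yC C2 yC2; apply/subsetP => a /setDP[aC aC2].
have [->|ay] := eqVneq a y; first exact: component_refl.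
have ya : a \in component G C y by rewrite (connected_component cC).
have [w [wC aw wy]] := component_last_step yC ya ay.
have av : forall b, b \in component G (C :\ y) a -> b \notin C2.
  move=> b ab; apply: contra aC2 => bC2; rewrite component_sym in ab.
  by rewrite /C2 -(component_eq bC2).
have aw' : w \in component G (C :\: C2) a.
  apply: (subsetP (componentS _ (subxx G) _)) (subsetP (component_avoid av) _ aw).
  exact: setSD (subsetDl _ _).
rewrite component_sym; apply: component_adj aw' _; rewrite /adj_in wy !in_setD yC yC2 av //=.
by case/setD1P: wC => _ ->.
Qed.

(** In a component [D] that is too big, take a smallest connected [C1] of order at least [K]
    avoiding a root [x] and leaving [D :\: C1] connected. Minimality bounds [C1] by [d * K + 1]. *)
Lemma peel C K : 0 < K -> C != set0 -> (forall x, x \in C -> K <= #|component G C x|) ->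
  exists C1, [/\ C1 \subset C, connected C1, K <= #|C1| <= d.+2 * K
    & forall y, y \in C :\: C1 -> K <= #|component G (C :\: C1) y|].
Proof.
move=> K0 /set0Pn[x xC] big; set D := component G C x.
have DC : D \subset C by apply: component_sub.
have cD : connected D by apply: component_connected.
have xD : x \in D by apply: component_refl.
have outD C1 y : C1 \subset D -> y \in C -> y \notin D -> K <= #|component G (C :\: C1) y|.
  move=> C1D yC yD; apply: leq_trans (big y yC) (subset_leq_card (component_avoid _)).
  move=> z yz; apply: contra yD => /(subsetP C1D) zD.
  by rewrite component_sym in yz; rewrite /D -(component_eq zD).
have [smallD|bigD] := leqP #|D| (d.+2 * K).
  exists D; split=> //; first by rewrite big // smallD.
  by move=> y /setDP[yC yD]; apply: outD.
pose Q C1 := [&& C1 \subset D :\ x, K <= #|C1|, connected C1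
  & D :\: C1 \subset component G (D :\: C1) x].
have [C0 Q0] : exists C0, Q C0.
  have [|z zD zK] := @big_branch D x K cD xD; first by rewrite (cardsD1 x) xD in bigD; lia.
  exists (component G (D :\ x) z); have sub := component_sub G zD.
  apply/and4P; split=> //; first exact: component_connected.
  apply: component_detach => //; apply/negP => /(subsetP sub); by rewrite !inE eqxx.
case: (arg_minnP (fun C1 : {set V} => #|C1|) Q0) => C1 /and4P[C1x C1K cC1 cDC1] minC1.
have C1D : C1 \subset D by apply: subset_trans C1x (subsetDl _ _).
have xDC1 : x \in D :\: C1.
  by rewrite inE xD andbT; apply/negP => /(subsetP C1x); rewrite !inE eqxx.
have [t [y [tD yC1 ty]]] : exists t y, [/\ t \in D :\: C1, y \in C1 & adj G t y].
  case: (boolP [exists t in D :\: C1, [exists y in C1, adj G t y]]).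
    by move=> /existsP[t /andP[tD /existsP[y /andP[yC ty]]]]; exists t, y.
  move=> /existsPn no; have [z /andP[zC1 _]] := existsP cC1.
  have : component G D x \subset D :\: C1.
    apply: component_min => // a b aD /and3P[_ bD ab]; rewrite inE bD andbT.
    by apply/negP => bC1; case/negP: (no a); rewrite aD; apply/existsP; exists b; rewrite bC1.
  by rewrite connected_component // => /subsetP/(_ z (subsetP C1D _ zC1)); rewrite inE zC1.
(* Otherwise a big branch of [C1] at [y] would be a smaller admissible set: the rest of [C1] hangs
   on [y], and [y] is joined through [t] to what lies outside [C1]. *)
have C1le : #|C1 :\ y| <= d * K.
  rewrite leqNgt; apply/negP => /(big_branch cC1 yC1)[z zC1 zK].
  set C2 := component G (C1 :\ y) z in zK.
  have C2C1 : C2 \subset C1 :\ y by apply: component_sub.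
  have yC2 : y \notin C2 by apply/negP => /(subsetP C2C1); rewrite !inE eqxx.
  have C2C1' : C2 \subset C1 by apply: subset_trans C2C1 (subsetDl _ _).
  suff /minC1 : Q C2.
    by rewrite leqNgt => /negP; apply; apply: proper_card; apply/properP; split=> //; exists y.
  have sD : D :\: C1 \subset D :\: C2 by apply: setDS.
  apply/and4P; split=> //; first exact: subset_trans C1x.
    exact: component_connected.
  have tx : t \in component G (D :\: C2) x.
    by apply: (subsetP (componentS _ (subxx G) sD)); apply: (subsetP cDC1).
  have yx : y \in component G (D :\: C2) x.
    by apply: component_adj tx _; rewrite /adj_in ty (subsetP sD) // inE yC2 (subsetP C1D).
  apply/subsetP => a /setDP[aD aC2]; have [aC1|aC1] := boolP (a \in C1).
    rewrite -(component_eq yx); apply: (subsetP (componentS _ (subxx G) (setSD C2 C1D))).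
    by apply: (subsetP (component_detach cC1 yC1 yC2)); rewrite inE aC2.
  apply: (subsetP (componentS _ (subxx G) sD)); apply: (subsetP cDC1).
  by rewrite inE aC1.
have C1le' : #|C1| <= (d * K).+1 by rewrite (cardsD1 y) yC1.
exists C1; split=> //; first exact: subset_trans DC.
  by rewrite C1K (leq_trans C1le') // !mulSnr -addnA -addn1 leq_add2l addn_gt0 K0.
(* The remainder of [D] is connected and has at least [K] vertices: more than [(d + 2) * K], minus
   at most [d * K + 1]. *)
move=> y' /setDP[yC yC1']; have [yD|] := boolP (y' \in D); last exact: outD.
apply: (@leq_trans #|D :\: C1|).
  rewrite cardsDS // leq_subRL ?subset_leq_card //; apply: leq_trans (ltnW bigD).
  by rewrite !mulSnr leq_add2r (leq_trans C1le') // -addn1 leq_add2l.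
apply: subset_leq_card; apply: (subset_trans cDC1).
have yx : y' \in component G (D :\: C1) x by apply: (subsetP cDC1); rewrite inE yC1'.
by rewrite -(component_eq yx) componentS // setSD.
Qed.

Lemma split_pieces C K : 0 < K -> (forall x, x \in C -> K <= #|component G C x|) ->
  exists P : {set {set V}}, partition P C /\
    forall S, S \in P -> connected S /\ K <= #|S| <= d.+2 * K.
Proof.
move=> K0; have [k] := ubnP #|C|; elim: k C => // k IH C ltCk big.
have [->|C0] := eqVneq C set0.
  by exists set0; split=> [|S]; rewrite ?inE // partition_set0.
have [C1 [C1C cC1 szC1 big1]] := peel K0 C0 big.
have C1n0 : C1 != set0 by rewrite -card_gt0; lia.
have [|P [pP szP]] := IH (C :\: C1) _ big1.
  by rewrite cardsDS //; have := subset_leq_card C1C; lia.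
exists (C1 |: P); split; last first.
  by move=> S /setU1P[->//|/szP].
have /and3P[/eqP covP trP P0] := pP.
have [|trP' _] := @trivIsetU1 _ C1 P _ trP P0.
  move=> B BP; rewrite disjoint_sym disjoints_subset.
  apply: subset_trans (bigcup_sup B BP) _; rewrite -/(cover P) covP.
  by rewrite setDE subsetIr.
apply/and3P; split=> //.
  by rewrite /cover bigcup_setU big_set1 -/(cover P) covP -{2}(setID C C1) (setIidPr C1C).
by rewrite !inE negb_or eq_sym C1n0.
Qed.
End Pieces.

(** * The hypercube and its isoperimetry *)

Section Hypercube.
Local Open Scope nat_scope.
Variable d : nat.
Notation V := (hvert d).
Implicit Types (x y z : V) (i j : 'I_d) (S A B : {set V}).

Definition flip x i : V := [ffun j => x j (+) (j == i)].

Lemma flip_inj x : injective (flip x).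
Proof.
move=> i j /ffunP/(_ i); rewrite !ffunE eqxx => /addbI/esym.
by case: eqP.
Qed.

Lemma hadjP x y : reflect (exists i, y = flip x i) (hadj x y).
Proof.
apply: (iffP cards1P) => -[i E]; exists i.
  apply/ffunP => j; rewrite ffunE; have /setP/(_ j) := E; rewrite !inE => <-.
  by case: (x j); case: (y j).
by apply/setP => j; rewrite !inE E ffunE; case: (x j); case: (j == i).
Qed.

Lemma hadj_sym x y : hadj x y = hadj y x.
Proof.
by rewrite /hadj; congr (_ == _); apply: eq_card => i; rewrite !inE eq_sym.
Qed.

Lemma hadjxx x : hadj x x = false.
Proof.
by apply/negP => /hadjP[i] /ffunP/(_ i); rewrite ffunE eqxx; case: (x i).
Qed.

Lemma in_hedges x y : ([set x; y] \in hedges d) = hadj x y.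
Proof.
rewrite inE; apply/existsP/idP => [[a /existsP[b /andP[ab /eqP E]]]|xy]; last first.
  by exists x; apply/existsP; exists y; rewrite xy eqxx.
have xe : x \in [set a; b] by rewrite -E set21.
have ye : y \in [set a; b] by rewrite -E set22.
have ae : a \in [set x; y] by rewrite E set21.
have be : b \in [set x; y] by rewrite E set22.
case/set2P: xe => Ex; case/set2P: ye => Ey; subst x y => //.
- by move: be ab; rewrite setUid => /set1P ->.
- by rewrite hadj_sym.
- by move: ae ab; rewrite setUid => /set1P ->.
Qed.

Definition nb x : {set V} := [set y | hadj x y].

Lemma nb_flip x : nb x = [set flip x i | i : 'I_d].
Proof.
apply/setP => y; rewrite inE; apply/hadjP/imsetP => [[i ->]|[i _ ->]]; by exists i.
Qed.

Lemma card_nb x : #|nb x| = d.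
Proof. by rewrite nb_flip card_imset ?card_ord //; exact: flip_inj. Qed.

Lemma card_nbI x B : #|nb x :&: B| = \sum_(y in B) hadj x y.
Proof.
rewrite -sum1_card big_mkcond [RHS]big_mkcond; apply: eq_bigr => y _.
by rewrite !inE; case: hadj; case: (y \in B).
Qed.

Lemma sum_nbIC A B : \sum_(x in A) #|nb x :&: B| = \sum_(x in B) #|nb x :&: A|.
Proof.
under eq_bigr do rewrite card_nbI; rewrite exchange_big /=.
apply: eq_bigr => y _; rewrite card_nbI; apply: eq_bigr => x _; by rewrite hadj_sym.
Qed.

(** Induction along a coordinate on which two vertices of [S] differ. The edges across it form a
    matching, hence add at most 2 per vertex of the smaller half; that half has at most
    [2 ^ (k - 1)] vertices, so its induction bound is lower by exactly 2 per vertex. *)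
Lemma inner_degree k S : #|S| <= 2 ^ k ->
  \sum_(x in S) #|nb x :&: S| <= 2 * k * #|S|.
Proof.
have [m] := ubnP #|S|; elim: m S k => // m IH S k ltSm.
have [->|[x xS]] := set_0Vmem S; first by rewrite big_set0.
have [E|[y /setD1P[yx yS]]] := set_0Vmem (S :\ x).
  have -> : S = [set x] by rewrite -(setD1K xS) E setU0.
  move=> _; rewrite big_set1; have -> : nb x :&: [set x] = set0; last by rewrite cards0.
  by apply/setP => z; rewrite !inE; case: eqP => [->|]; rewrite ?hadjxx // andbF.
have [i xyi] : exists i, x i != y i.
  apply/existsP; apply: contraNT yx => /existsPn E; apply/eqP/ffunP => i.
  by have := E i; rewrite negbK => /eqP ->.
case: k => [|k] leS.
  have := leS; rewrite (cardsD1 x) xS (cardsD1 y) !inE yx yS; lia.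
pose P b := [set z in S | z i == b].
have defS b : S = P b :|: P (~~ b).
  by apply/setP => z; rewrite !inE -andb_orr; case: (z i); case: b; rewrite ?andbT.
have disP b : P b :&: P (~~ b) = set0.
  by apply/setP => z; rewrite !inE; case: (z i); case: b; rewrite ?andbF ?andbT //= ?andbF.
have cardP b : #|P b| + #|P (~~ b)| = #|S|.
  by rewrite [in RHS](defS b) cardsU disP cards0 subn0.
have P_gt0 b : 0 < #|P b|.
  rewrite card_gt0; apply/set0Pn.
  case: (boolP (x i == b)) => [xb|xb]; first by exists x; rewrite inE xS.
  by exists y; rewrite inE yS; move: xb xyi; case: (x i); case: (y i); case: b.
have cross b z : z \in P b -> #|nb z :&: P (~~ b)| <= 1.
  rewrite inE => /andP[_ /eqP zb]; rewrite -(cards1 (flip z i)); apply: subset_leq_card.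
  apply/subsetP => w; rewrite !inE => /andP[/hadjP[j ->]] /andP[_].
  by rewrite ffunE zb; have [->//|_] := eqVneq i j; rewrite addbF; case: (b).
have [b leb] : exists b, #|P (~~ b)| <= #|P b|.
  by have [] := leqP #|P true| #|P false|; [exists false|exists true; rewrite ltnW].
have split_sum : \sum_(z in S) #|nb z :&: S| =
    \sum_(z in P b) #|nb z :&: P b| + \sum_(z in P (~~ b)) #|nb z :&: P (~~ b)| +
    2 * \sum_(z in P (~~ b)) #|nb z :&: P b|.
  have splitN z : #|nb z :&: S| = #|nb z :&: P b| + #|nb z :&: P (~~ b)|.
    rewrite {1}(defS b) setIUr cardsU -setIIr disP setI0 cards0 subn0 //.
  under eq_bigr do rewrite splitN.
  rewrite (eq_bigl [in [predU P b & P (~~ b)]]); last by move=> z; rewrite {1}(defS b) in_setU.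
  rewrite bigU /=; last by rewrite -setI_eq0 disP.
  by rewrite !big_split /= (sum_nbIC (P b) (P (~~ b))) mul2n -addnn -!addnA; congr (_ + _); rewrite addnA addnC.
have IHb : \sum_(z in P b) #|nb z :&: P b| <= 2 * k.+1 * #|P b|.
  by apply: IH; have := cardP b; have := P_gt0 (~~ b); lia.
have IHnb : \sum_(z in P (~~ b)) #|nb z :&: P (~~ b)| <= 2 * k * #|P (~~ b)|.
  by apply: IH; have := cardP b; have := P_gt0 b; rewrite expnS in leS; lia.
have crossb : \sum_(z in P (~~ b)) #|nb z :&: P b| <= #|P (~~ b)|.
  rewrite -sum1_card; apply: leq_sum => z zP; have := cross (~~ b) z zP.
  by rewrite negbK.
rewrite split_sum -(cardP b); nia.
Qed.

Definition hybrid n x y : V := [ffun i : 'I_d => if i < n then y i else x i].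

Lemma hybridK n x y : hybrid n (hybrid n x y) (hybrid n y x) = x.
Proof. by apply/ffunP => i; rewrite !ffunE; case: ltnP. Qed.

Lemma hybridS j x y :
  hybrid j.+1 x y = hybrid j x y \/ hybrid j.+1 x y = flip (hybrid j x y) j.
Proof.
have [E|nE] := eqVneq (x j) (y j); [left|right]; apply/ffunP => i; rewrite !ffunE ltnS leq_eqVlt.
  by case: eqP => //= /val_inj ->; rewrite ltnn E.
case: eqP => [/val_inj ->|/eqP ij] /=.
  by rewrite ltnn eqxx; move: nE; case: (x j); case: (y j).
have -> : (i == j) = false by apply/negbTE; rewrite -val_eqE.
by rewrite addbF.
Qed.

(* Some step of the chain [hybrid 0 x y = x, hybrid 1 x y, ...] from [x \in S] to
   [y \notin S] leaves [S]; for fixed [j], the pair of hybrids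
   [(hybrid j x y, hybrid j y x)] determines [(x, y)]. *)
Lemma edge_boundary S : #|S| * #|~: S| <= 2 ^ d * \sum_(x in S) #|nb x :\: S|.
Proof.
have cardV : #|{: V}| = 2 ^ d by rewrite card_ffun card_bool card_ord.
pose D j := [set z in S | flip z j \notin S].
have -> : \sum_(x in S) #|nb x :\: S| = \sum_j #|D j|.
  transitivity (\sum_(x in S) \sum_(j < d) (flip x j \notin S)).
    apply: eq_bigr => x _; rewrite -sum1_card nb_flip.
    rewrite big_mkcond /= (eq_bigr (fun y => (y \in [set flip x i | i : 'I_d]) && (y \notin S) : nat)).
      rewrite (eq_bigr (fun y => if y \in [set flip x i | i : 'I_d] then (y \notin S : nat) else 0)).
        by rewrite -big_mkcond big_imset //= => i j _ _; apply: flip_inj.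
      by move=> y _; case: ifP.
    by move=> y _; rewrite inE andbC; case: andP.
  rewrite exchange_big; apply: eq_bigr => j _; rewrite -sum1_card big_mkcond [RHS]big_mkcond.
  by apply: eq_bigr => x _; rewrite inE; case: (x \in S) => //=; case: ifP.
rewrite -cardsX big_distrr /=.
pose H j := [set u : V * V | (hybrid j u.1 u.2 \in S) && (hybrid j.+1 u.1 u.2 \notin S)].
apply: (@leq_trans #|\bigcup_(j : 'I_d) H j|).
  apply: subset_leq_card; apply/subsetP => -[x y]; rewrite !inE /= => /andP[xS yS].
  apply/bigcupP; suff [j] : exists j : 'I_d, (x, y) \in H j by exists j.
  apply/existsP; apply: contraNT yS => /existsPn noj.
  have all n : n <= d -> hybrid n x y \in S.
    elim: n => [|n IH] nd; first by have -> : hybrid 0 x y = x by apply/ffunP => i; rewrite ffunE.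
    by have := noj (Ordinal nd); rewrite inE /= IH ?(ltnW nd) //= negbK.
  have -> : y = hybrid d x y by apply/ffunP => i; rewrite ffunE ltn_ord.
  exact: all.
apply: (@leq_trans (\sum_(j : 'I_d) #|H j|)).
  apply: (big_ind2 (fun (A : {set V * V}) n => #|A| <= n)) => [|A1 n1 A2 n2 h1 h2|//].
    by rewrite cards0.
  exact: leq_trans (leq_card_setU A1 A2) (leq_add h1 h2).
apply: leq_sum => j _; rewrite mulnC -cardV -cardsT -cardsX.
pose sw (u : V * V) := (hybrid j u.1 u.2, hybrid j u.2 u.1).
have sw_inj : injective sw.
  by apply: (can_inj (g := sw)) => -[x y]; rewrite /sw /= !hybridK.
rewrite -(card_imset (mem (H j)) sw_inj); apply: subset_leq_card.
apply/subsetP => _ /imsetP[[x y] /[!inE] /andP[/= xS yS] ->] /=.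
rewrite andbT xS /=; have [E|<-//] := hybridS j x y.
by rewrite E xS in yS.
Qed.

Lemma adj_degree (G : {set {set V}}) x : G \subset hedges d ->
  #|[set y | adj G x y]| <= d.
Proof.
move=> sG; rewrite -[X in _ <= X](card_nb x); apply: subset_leq_card.
by apply/subsetP => y; rewrite !inE => /(subsetP sG); rewrite in_hedges.
Qed.

End Hypercube.

(** * First round: many neighbours in large components *)

Section Independence.
Variables (R : realFieldType) (T : finType) (I : eqType).

Lemma EX_prod (p : R) (E : {set T}) (F : I -> {set T}) (f : I -> {set T} -> R)
    (r : seq I) : uniq r ->
  (forall i G, f i G = f i (G :&: F i)) ->
  {in r &, forall i j, i != j -> F i :&: F j = set0} ->
  EX p E (fun G => \prod_(i <- r) f i G) = \prod_(i <- r) EX p E (f i).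
Proof.
move=> + fF; elim: r => [|i r IH] /= => [_ _|/andP[ir ur] dis].
  by rewrite big_nil -[RHS](EX_cst p E); apply: eq_EX => G _; rewrite big_nil.
rewrite big_cons -IH //; last first.
  by move=> a b ar br; apply: dis; rewrite inE ?ar ?br orbT.
rewrite -(EX_indep _ _ (fF i)); first by apply: eq_EX => G _; rewrite big_cons.
move=> G; rewrite big_seq [RHS]big_seq; apply: eq_bigr => j jr.
rewrite fF [RHS]fF setIDAC; congr (f j _); apply/esym/setDidPl.
rewrite -setI_eq0 -setIA [F j :&: _]setIC dis ?setI0 ?inE ?eqxx ?jr ?orbT //.
by apply: contraNneq ir => ->.
Qed.
End Independence.

(** The empty set is excluded because it lies in every [X]; disjoint vertex sets thus get disjoint
    [inside], as independence requires. *)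
Definition inside (V : finType) (X : {set V}) : {set {set V}} :=
  [set e | (e != set0) && (e \subset X)].

Lemma component_inside (V : finType) (G : {set {set V}}) X x :
  component G X x = component (G :&: inside X) X x.
Proof.
apply/setP => y; rewrite !inE; apply: eq_connect => a b.
rewrite /adj_in /adj !inE; case aX : (a \in X); case bX : (b \in X) => //=.
have -> : [set a; b] != set0 by apply/set0Pn; exists a; rewrite set21.
by rewrite subUset !sub1set aX bX /= andbT.
Qed.

Definition large (V : finType) (G : {set {set V}}) (K : nat) : {set V} :=
  [set x | (K <= #|component G setT x|)%N].

Section Branching.
Variables (R : realFieldType) (d : nat) (p rho : R) (N k K : nat).
Notation V := (hvert d).
Notation E := (hedges d).
Notation g := (1 - p + p * rho).
Hypotheses (p_ge0 : 0 <= p) (p_le1 : p <= 1) (rho_gt0 : 0 < rho) (rho_le1 : rho <= 1).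
(** [g ^+ N] is the generating function at [rho] of a binomial offspring law with parameters [N] and
    [p]; [gN] makes [rho] an upper bound for the extinction probability. *)
Hypotheses (leK : (K <= 2 ^ k)%N) (gN : g ^+ N <= rho).
Implicit Types (X S : {set V}) (F G : {set {set V}}) (x y : V).

Let g_gt0 : 0 < g.
Proof.
have [->|p1] := eqVneq p 1; first by rewrite subrr add0r mul1r.
have : p < 1 by rewrite lt_neqAle p1.
by have := mulr_ge0 p_ge0 (ltW rho_gt0); lra.
Qed.

Let g_le1 : g <= 1.
Proof. have : p * rho <= p * 1 by rewrite ler_wpM2l. lra. Qed.

Definition reach G X S : {set V} := \bigcup_(x in S) component G X x.

(** Of the [N + 2 * k] neighbours in [X], on average at most [2 * k] lie in [S] by [inner_degree],
    so at least [N * #|S|] edges leave [S]. *)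
Lemma boundary_card X S F : S \subset X -> (#|S| <= 2 ^ k)%N ->
  (forall x, x \in X -> N + 2 * k <= #|nb x :&: X|)%N ->
  (forall x y, x \in S -> y \in X :\: S -> hadj x y -> [set x; y] \in F) ->
  (N * #|S| <= #|F|)%N.
Proof.
move=> sSX leS degX bF.
pose P := [set u : V * V | [&& u.1 \in S, u.2 \in X :\: S & hadj u.1 u.2]].
have cardP : #|P| = (\sum_(x in S) #|nb x :&: (X :\: S)|)%N.
  transitivity (\sum_(x in S) \sum_(y in X :\: S) hadj x y)%N; last first.
    by apply: eq_bigr => x _; rewrite card_nbI.
  rewrite pair_big /= -sum1_card big_mkcond [RHS]big_mkcond; apply: eq_bigr => -[x y] _.
  by rewrite in_set /=; case: (x \in S) => //=; case: (y \in X :\: S) => //=; case: hadj.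
have : (#|P| <= #|F|)%N.
  have inj : {in P &, injective (fun u : V * V => [set u.1; u.2])}.
    move=> [a b] [a' b']; rewrite !in_set /= => /and3P[aS /andP[bS _] _] /and3P[aS' /andP[bS' _] _] EQ.
    have : a \in [set a'; b'] by rewrite -EQ set21.
    case/set2P => [<-|Eab]; last by move: aS; rewrite Eab (negPf bS').
    have : b \in [set a'; b'] by rewrite -EQ set22.
    by case/set2P => [Eba|->//]; move: bS; rewrite Eba aS'.
  rewrite -(card_in_imset inj); apply: subset_leq_card; apply/subsetP => z /imsetP[[a b]].
  by rewrite in_set /= => /and3P[aS bX ab] ->; apply: bF.
have : (N * #|S| + 2 * k * #|S| <= #|P| + \sum_(x in S) #|nb x :&: S|)%N.
  rewrite cardP -big_split /= -mulnDl mulnC -sum_nat_const; apply: leq_sum => x xS.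
  apply: leq_trans (degX x (subsetP sSX x xS)) _.
  by rewrite setIDA cardsD -setIA (setIidPr sSX) subnK // subset_leq_card // setIS.
have := inner_degree leS; lia.
Qed.

(* Edges leaving the explored set [S] are revealed one at a time and collected
   in [F]; the potential [rho ^ #|S| / g ^ #|F|] is then a martingale. *)
Lemma explore X S F : S \subset X -> F \subset E ->
  (forall x, x \in X -> N + 2 * k <= #|nb x :&: X|)%N ->
  EX p (E :\: F) (fun G => (#|reach G X S| < K)%N%:R) * g ^+ #|F| <= rho ^+ #|S|.
Proof.
move=> + + degX; have [n] := ubnP #|E :\: F|.
elim: n S F => // n IH S F ltn sSX sFE.
have S_reach G : S \subset reach G X S.
  by apply/subsetP => x xS; apply/bigcupP; exists x => //; apply: component_refl.
have [leKS|ltSK] := leqP K #|S|.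
  rewrite (_ : EX _ _ _ = 0) ?mul0r ?exprn_ge0 ?ltW // -[RHS](EX_cst p (E :\: F)).
  apply: eq_EX => G _; rewrite ltnNge (leq_trans leKS) //.
  exact: subset_leq_card.
case: (boolP [exists x in S, [exists y in X :\: S, hadj x y && ([set x; y] \notin F)]]); last first.
  (* The exploration has stopped early: every edge leaving [S] is in [F], so [F] is so large that
     [g ^+ #|F|] alone is at most [rho ^+ #|S|]. *)
  move=> /existsPn noxy; have leNS : (N * #|S| <= #|F|)%N.
    apply: (boundary_card sSX) => //; first by rewrite (leq_trans (ltnW ltSK)).
    move=> x y xS yX xy; have := noxy x; rewrite xS /= => /existsPn/(_ y).
    by rewrite yX xy /= negbK.
  apply: (@le_trans _ _ (1 * g ^+ #|F|)).
    rewrite ler_wpM2r ?exprn_ge0 ?(ltW g_gt0) // -[X in _ <= X](EX_cst p (E :\: F)).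
    by apply: le_EX => // G _; rewrite lern1 leq_b1.
  rewrite mul1r; apply: (@le_trans _ _ (g ^+ (N * #|S|))).
    by apply: ler_wiXn2l => //; exact: ltW.
  by rewrite exprM lerXn2r ?nnegrE ?exprn_ge0 // ltW.
move=> /existsP[x /andP[xS /existsP[y /andP[yX /andP[xy xyF]]]]].
set e := [set x; y] in xyF.
have eE : e \in E by rewrite in_hedges.
have yS : y \notin S by case/setDP: yX.
have yX' : y \in X by case/setDP: yX.
have eEF : e \in E :\: F by rewrite in_setD xyF.
have EFe : E :\: (e |: F) = (E :\: F) :\ e by rewrite setDDl setUC.
have -> : E :\: F = e |: (E :\: (e |: F)) by rewrite EFe setD1K.
have eF' : e \notin E :\: (e |: F) by rewrite EFe in_setD1 eqxx.
have cardF : #|e |: F| = #|F|.+1 by rewrite cardsU1 xyF.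
have ltn' : (#|E :\: (e |: F)| < n)%N.
  by rewrite EFe; move: ltn; rewrite (cardsD1 e) eEF.
have sF' : e |: F \subset E by rewrite subUset sub1set eE.
have sy : y |: S \subset X by rewrite subUset sub1set yX'.
have := IH (y |: S) _ ltn' sy sF'; have := IH S _ ltn' sSX sF'.
rewrite cardF cardsU1 yS add1n !exprS.
rewrite EX_setU1 //; set b := EX p _ _; set a := EX p _ (fun G => (#|reach G X (y |: S)| < K)%N%:R).
set a' := EX p _ _.
(* When [e] is open, all that is reached from [y |: S] is also reached from [S]. *)
have aa' : a' <= a.
  apply: le_EX => // G _; rewrite ler_nat; case: ltnP => //= lt1; rewrite lt0b.
  apply: leq_ltn_trans lt1; apply: subset_leq_card; apply/bigcupsP => z.
  case/setU1P => [->|zS]; last first.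
    apply: subset_trans (bigcup_sup z zS); apply: componentS; rewrite ?subxx //.
    exact: subsetUr.
  apply: subset_trans (bigcup_sup x xS).
  have yx : y \in component (e |: G) X x.
    apply: component_adj (component_refl _ _ _) _.
    by rewrite /adj_in yX' (subsetP sSX) //= /adj setU11.
  rewrite -(component_eq yx); apply: componentS; rewrite ?subxx //.
  exact: subsetUr.
move: aa' (exprn_gt0 #|F| g_gt0) (exprn_gt0 #|S| rho_gt0).
move: (g ^+ #|F|) (rho ^+ #|S|) => gF rS aa' gF0 rS0 hb ha.
(* Both outcomes put [e] into [F], so both induction hypotheses carry one more factor [g]; averaging
   [rho * rS] and [rS] with weights [p] and [1 - p] gives exactly [g * rS]. *)
rewrite -(ler_pM2r g_gt0).
apply: (@le_trans _ _ (p * (a * (g * gF)) + (1 - p) * (b * (g * gF)))).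
  have -> : (p * a' + (1 - p) * b) * gF * g = p * (a' * (g * gF)) + (1 - p) * (b * (g * gF)) by ring.
  by rewrite lerD2r ler_wpM2l // ler_wpM2r // mulr_ge0 // ltW.
apply: (@le_trans _ _ (p * (rho * rS) + (1 - p) * rS)); last first.
  by rewrite le_eqVlt; apply/orP; left; apply/eqP; ring.
by apply: lerD; apply: ler_wpM2l => //; rewrite subr_ge0.
Qed.

Lemma small_component_prob X x : x \in X ->
  (forall x, x \in X -> N + 2 * k <= #|nb x :&: X|)%N ->
  EX p E (fun G => (#|component G X x| < K)%N%:R) <= rho.
Proof.
move=> xX degX; have := @explore X [set x] set0.
rewrite sub1set sub0set setD0 cards0 cards1 expr0 mulr1 expr1 => /(_ xX isT degX).
by congr (_ <= _); apply: eq_EX => G _; rewrite /reach big_set1.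
Qed.

(* The subcubes fixing the first [b] coordinates to those of a neighbour
   [flip v i], [i < b], give independent trials. *)
Lemma few_large_neighbours v b t : (N + 2 * k + b <= d)%N ->
  EX p E (fun G => (#|nb v :&: large G K| < t)%N%:R) <=
  2 ^+ t * ((1 + rho) / 2) ^+ b.
Proof.
move=> led; pose X (i : 'I_d) : {set V} :=
  [set x : V | [forall j : 'I_d, (j < b)%N ==> (x j == flip v i j)]].
pose r := [seq i : 'I_d <- enum 'I_d | (i < b)%N].
have ur : uniq r by rewrite filter_uniq // enum_uniq.
have szr : size r = b.
  have -> : size r = size [seq i <- iota 0 d | (i < b)%N].
    by rewrite -val_enum_ord filter_map size_map.
  rewrite -[d](subnKC (_ : b <= d)%N); last by lia.
  rewrite iotaD filter_cat size_cat add0n.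
  rewrite (@eq_in_filter _ _ predT); last by move=> j; rewrite mem_iota.
  rewrite filter_predT size_iota (@eq_in_filter _ _ pred0) ?filter_pred0 ?addn0 //.
  by move=> j; rewrite mem_iota /= => /andP[]; rewrite leqNgt => /negPf.
have xX i : flip v i \in X i.
  by rewrite inE; apply/forallP => j; rewrite eqxx implybT.
have degX i x : x \in X i -> (N + 2 * k <= #|nb x :&: X i|)%N.
  rewrite inE => /forallP xi.
  apply: (@leq_trans #|[set flip x j | j in [set j : 'I_d | b <= j]]|)%N; last first.
    apply: subset_leq_card; apply/subsetP => _ /imsetP[j + ->]; rewrite inE => bj.
    rewrite in_setI !inE; apply/andP; split; first by apply/hadjP; exists j.
    apply/forallP => l; apply/implyP => lb; rewrite ffunE.
    have -> : (l == j) = false by apply: contraTF lb => /eqP ->; rewrite -leqNgt.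
    by rewrite addbF; apply: (implyP (xi l)).
  rewrite card_imset; last exact: flip_inj.
  have : (#|[set j : 'I_d | b <= j]| + size r = d)%N.
    rewrite -[X in (_ = X)]card_ord -(cardsC [set j : 'I_d | (b <= j)%N]); congr addn.
    rewrite cardE; congr size; rewrite /r enumT; apply: eq_filter => j.
    by rewrite !inE ltnNge.
  by rewrite szr; lia.
have disX i j : i \in r -> j \in r -> i != j -> inside (X i) :&: inside (X j) = set0.
  rewrite !mem_filter => /andP[ib _] /andP[jb _] ij.
  apply/setP => e; rewrite !inE; apply/negbTE/negP.
  move=> /andP[/andP[/set0Pn[x xe] ei] /andP[_ ej]].
  have := subsetP ei x xe; have := subsetP ej x xe; rewrite !inE => /forallP/(_ i) + /forallP/(_ i).
  by rewrite ib /= !ffunE eqxx (negPf ij) addbF => /eqP ->; case: (v i).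
pose s i G := (#|component G (X i) (flip v i)| < K)%N.
(* Exponential Markov inequality in base 2: the product of the [f i] is 2 to minus the number of
   successful trials, and each factor has mean at most [(1 + rho) / 2]. *)
pose f i G : R := if s i G then 1 else 2^-1.
have sF i G : s i G = s i (G :&: inside (X i)) by rewrite /s -component_inside.
have fF i G : f i G = f i (G :&: inside (X i)) by rewrite /f -sF.
apply: (@le_trans _ _ (2 ^+ t * EX p E (fun G => \prod_(i <- r) f i G))).
  rewrite -EXZ; apply: le_EX => // G _.
  have prodE : \prod_(i <- r) f i G = 2^-1 ^+ count (fun i => ~~ s i G) r.
    elim: (r) => [|i l IHl]; first by rewrite big_nil.
    by rewrite big_cons /= exprD IHl /f; case: (s i G); rewrite //= expr0.
  have cnt : (count (fun i => ~~ s i G) r <= #|nb v :&: large G K|)%N.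
    rewrite -size_filter -(size_map (flip v)) -(card_uniqP _); last first.
      by rewrite (map_inj_uniq (@flip_inj d v)) filter_uniq.
    apply: subset_leq_card; apply/subsetP => _ /mapP[i + ->].
    rewrite mem_filter /s -leqNgt => /andP[big _].
    rewrite !inE; apply/andP; split; first by apply/hadjP; exists i.
    apply: leq_trans big (subset_leq_card (componentS _ (subxx _) (subsetT _))).
  rewrite prodE; case: ltnP => /= [lt|_]; last by rewrite mulr_ge0 ?exprn_ge0 ?invr_ge0 ?ler0n.
  rewrite exprVn -ler_pdivrMr ?invr_gt0 ?exprn_gt0 // invrK mul1r.
  by rewrite ler_weXn2l ?ler1n // (leq_trans cnt) // ltnW.
rewrite ler_wpM2l ?exprn_ge0 // (EX_prod _ _ ur fF disX) -szr.
elim: (r) => [|i l IHl]; first by rewrite big_nil.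
rewrite big_cons /= exprS; apply: ler_pM => //.
- by apply: EX_ge0 => // G _; rewrite /f; case: ifP => // _; rewrite invr_ge0.
- by apply: prodr_ge0 => j _; apply: EX_ge0 => // G _; rewrite /f; case: ifP => // _; rewrite invr_ge0.
have -> : EX p E (f i) = 2^-1 + 2^-1 * EX p E (fun G => (s i G)%:R).
  rewrite -{1}(EX_cst p E 2^-1) -EXZ -EXD; apply: eq_EX => G _; rewrite /f.
  by case: (s i G); rewrite ?mulr1 ?mulr0 ?addr0 //=; field.
have := small_component_prob (xX i) (@degX i); rewrite -/(s i _); lra.
Qed.

End Branching.

(** * Joining two vertex classes by sprinkling *)

Lemma EX_avoid (R : realFieldType) (T : finType) (p : R) (E F : {set T}) :
  F \subset E -> EX p E (fun G => [disjoint F & G]%:R) = (1 - p) ^+ #|F|.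
Proof.
move=> sFE; rewrite (EX_restrict _ sFE); last first.
  by move=> G; rewrite -!setI_eq0 [G :&: F]setIC setIA setIid.
rewrite /EX (bigD1 set0) ?powersetE ?sub0set //= cards0 subn0 expr0 mul1r.
rewrite big1 ?addr0; last first.
  move=> G /andP[]; rewrite powersetE => sGF G0.
  by rewrite -setI_eq0 (setIidPr sGF) (negPf G0) mulr0.
by rewrite -setI_eq0 setI0 eqxx mulr1.
Qed.

Section Crossing.
Variables (R : realFieldType) (V T : finType) (E : {set T}) (d : nat).
Variables (p q a g : R) (ed : V * V -> T) (att : V -> {set T} -> bool).
Variables (sigma : V -> {set T}) (A B : {set V}).
Hypotheses (p01 : 0 <= p <= 1) (q01 : 0 <= q <= 1) (g_gt0 : 0 < g) (g_le1 : g <= 1).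
Hypothesis g_step : (1 - p) / g + p * (1 - a) / g ^+ (2 * d) <= 1.
Hypothesis AB0 : [disjoint A & B].
Hypothesis att_sigma : forall v G, att v G = att v (G :&: sigma v).
Hypothesis sigma_dis : {in A :|: B &, forall u v, u != v -> [disjoint sigma u & sigma v]}.

(** [G] is the round that opens the edges [ed u], [H] the round that attaches their ends. *)
Definition no_crossing (X : {set V * V}) (G H : {set T}) : bool :=
  [forall u in X, ~~ [&& ed u \in G, att u.1 H & att u.2 H]].

(* Induction on [X]: if the edge of [u \in X] is closed, drop [u]; if it is open
   but an end is not attached, drop every pair sharing an end with [u], whose
   attachments are still independent of what has been revealed. *)
Lemma no_crossing_prob (X : {set V * V}) :
  X \subset setX A B -> {in X &, injective ed} -> (forall u, u \in X -> ed u \in E) ->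
  (forall u, u \in X -> a <= EX q E (fun H => (att u.1 H && att u.2 H)%:R)) ->
  (forall x, #|[set u in X | u.1 == x]| <= d)%N ->
  (forall y, #|[set u in X | u.2 == y]| <= d)%N ->
  EX p E (fun G => EX q E (fun H => (no_crossing X G H)%:R)) <= g ^+ #|X|.
Proof.
have /andP[p0 p1] := p01; have /andP[q0 q1] := q01.
have [n] := ubnP #|X|; elim: n X => // n IH X ltn sX inj edE attX deg1 deg2.
have [X0|[u uX]] := set_0Vmem X.
  rewrite X0 cards0 expr0 -[X in _ <= X](EX_cst p E); apply: le_EX => // G _.
  rewrite -[X in _ <= X](EX_cst q E); apply: le_EX => // H _.
  by rewrite lern1 leq_b1.
pose Phi Y G := EX q E (fun H => (no_crossing Y G H)%:R).
pose X1 := X :\ u; pose X2 := [set w in X | (w.1 != u.1) && (w.2 != u.2)].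
have sX1 : X1 \subset X by apply: subsetDl.
have sX2 : X2 \subset X by apply/subsetP => w; rewrite inE => /andP[].
have sX21 : X2 \subset X1.
  apply/subsetP => w; rewrite !inE => /andP[-> /andP[wu _]]; rewrite andbT.
  by apply: contraNneq wu => ->.
have IHs (Y : {set V * V}) : Y \subset X1 -> EX p E (Phi Y) <= g ^+ #|Y|.
  move=> sY1; have sY := subset_trans sY1 sX1; apply: IH.
  - rewrite -ltnS; apply: leq_trans ltn; rewrite ltnS (cardsD1 u X) uX add1n ltnS.
    exact: subset_leq_card.
  - exact: subset_trans sX.
  - by move=> v w vY wY; apply: inj; apply: (subsetP sY).
  - by move=> v vY; apply: edE; apply: (subsetP sY).
  - by move=> v vY; apply: attX; apply: (subsetP sY).
  - move=> x; apply: leq_trans (deg1 x); apply: subset_leq_card.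
    by apply/subsetP => v; rewrite !inE => /andP[/(subsetP sY) -> ->].
  - move=> x; apply: leq_trans (deg2 x); apply: subset_leq_card.
    by apply/subsetP => v; rewrite !inE => /andP[/(subsetP sY) -> ->].
have eE := edE u uX; set e := ed u in eE.
have resE (Y : {set V * V}) : Y \subset X1 -> EX p (E :\ e) (Phi Y) = EX p E (Phi Y).
  move=> sY1; apply/esym/EX_restrict; first exact: subsetDl.
  move=> G; apply: eq_EX => H _; congr (_%:R); congr nat_of_bool.
  apply: eq_forallb => w; case wY : (w \in Y) => //=.
  have /setD1P[wu wX] := subsetP sY1 w wY.
  rewrite !inE edE // andbT; have -> : ed w != e by apply: contraNneq wu => /inj ->.
  by rewrite andbT.
have u12 : u.1 != u.2.
  have := subsetP sX u uX; rewrite inE => /andP[u1A u2B].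
  by apply: contraTneq u2B => <-; rewrite (disjointFr AB0 u1A).
have uAB v : v \in X -> (v.1 \in A :|: B) && (v.2 \in A :|: B).
  by move=> /(subsetP sX); rewrite !inE => /andP[-> ->]; rewrite orbT.
have closed G : Phi X G <= Phi X1 G.
  apply: le_EX => // H _; rewrite ler_nat.
  case: (boolP (no_crossing X G H)) => //= /forallP noX; rewrite lt0b.
  by apply/forallP => w; apply/implyP => /(subsetP sX1) wX; have := noX w; rewrite wX.
have open (G : {set T}) : Phi X (e |: G) <= (1 - a) * Phi X2 G.
  pose F := sigma u.1 :|: sigma u.2.
  pose f H : R := (~~ (att u.1 H && att u.2 H))%:R.
  apply: (@le_trans _ _ (EX q E (fun H => f H * (no_crossing X2 G H)%:R))).
    apply: le_EX => // H _; rewrite /f -natrM ler_nat mulnb.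
    case: (boolP (no_crossing X _ H)) => //= /forallP noX.
    have := noX u; rewrite uX setU11 /= => -> /=; rewrite lt0b; apply/forallP => w.
    apply/implyP => wX2; have := noX w; rewrite (subsetP sX2) //=.
    by apply: contra => /and3P[wG -> ->]; rewrite inE wG orbT.
  rewrite (EX_indep _ _ (F := F)) => [|H|H].
  - apply: ler_wpM2r; first by apply: EX_ge0 => // H _; rewrite ler0n.
    have -> : EX q E f = 1 - EX q E (fun H => (att u.1 H && att u.2 H)%:R).
      rewrite -mulN1r -EXZ -[X in X + _](EX_cst q E) -EXD; apply: eq_EX => H _.
      by rewrite /f; case: (_ && _); rewrite /= ?mulr1 ?subrr ?mulr0 ?addr0.
    by rewrite lerD2l lerN2 attX.
  - rewrite /f (att_sigma u.1 H) (att_sigma u.1 (H :&: F)) (att_sigma u.2 H) (att_sigma u.2 (H :&: F)).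
    by rewrite -!setIA (setIidPr (subsetUl _ _)) (setIidPr (subsetUr _ _)).
  - congr (_%:R); congr nat_of_bool; apply: eq_forallb => w; case wX : (w \in X2) => //=.
    have sep v : v \in A :|: B -> v != u.1 -> v != u.2 -> att v H = att v (H :\: F).
      move=> vAB v1 v2; rewrite att_sigma [RHS]att_sigma setIDAC; congr att.
      apply/esym/setDidPl; apply: disjointWl (subsetIr _ _) _.
      have /andP[u1 u2] := uAB u uX.
      rewrite -setI_eq0 setIUr (disjoint_setI0 (sigma_dis vAB u1 v1)).
      by rewrite (disjoint_setI0 (sigma_dis vAB u2 v2)) setU0.
    have /andP[w1 w2] := uAB w (subsetP sX2 w wX).
    have wXX := subsetP sX2 w wX.
    have := subsetP sX w wXX; rewrite inE => /andP[w1A w2B].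
    have := subsetP sX u uX; rewrite inE => /andP[u1A u2B].
    have AB x y : x \in A -> y \in B -> x != y.
      by move=> xA; apply: contraTneq => <-; rewrite (disjointFr AB0 xA).
    move: wX; rewrite inE => /andP[_ /andP[n1 n2]].
    have n3 : w.1 != u.2 by apply: AB.
    have n4 : w.2 != u.1 by rewrite eq_sym AB.
    by rewrite (sep _ w1 n1 n3) (sep _ w2 n4 n2).
have cardX1 : #|X| = #|X1|.+1 by rewrite (cardsD1 u X) uX.
(* At most [2 * d] pairs share an end with [u]; this loss is the factor [g ^+ (2 * d)] in
   [g_step]. *)
have cardX2 : (#|X| <= 2 * d + #|X2|)%N.
  have sub : X \subset X2 :|: ([set v in X | v.1 == u.1] :|: [set v in X | v.2 == u.2]).
    by apply/subsetP => v vX; rewrite !inE vX /=; case: eqP; case: eqP.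
  apply: leq_trans (subset_leq_card sub) _.
  rewrite addnC (leq_trans (leq_card_setU _ _)) // leq_add2l.
  rewrite (leq_trans (leq_card_setU _ _)) // mul2n -addnn.
  exact: leq_add (deg1 _) (deg2 _).
rewrite -/(Phi X) -[in X in X <= _](setD1K eE) EX_setU1; last by rewrite !inE eqxx.
have h1 : EX p (E :\ e) (Phi X) <= g ^+ #|X| / g.
  rewrite cardX1 exprSr mulfK ?gt_eqF //; apply: le_trans (IHs X1 (subxx _)).
  by rewrite -resE //; apply: le_EX => // G _; apply: closed.
have h2 : EX p (E :\ e) (fun G => Phi X (e |: G)) <= (1 - a) * (g ^+ #|X| / g ^+ (2 * d)).
  apply: (@le_trans _ _ ((1 - a) * EX p (E :\ e) (Phi X2))).
    by rewrite -EXZ; apply: le_EX => // G _; apply: open.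
  have a1 : 0 <= 1 - a.
    rewrite subr_ge0; apply: le_trans (attX u uX) _.
    rewrite -[X in _ <= X](EX_cst q E); apply: le_EX => // H _; by rewrite lern1 leq_b1.
  rewrite ler_wpM2l // resE // (le_trans (IHs X2 sX21)) //.
  rewrite ler_pdivlMr ?exprn_gt0 // -exprD ler_wiXn2l ?(ltW g_gt0) //.
  by rewrite addnC.
have -> : g ^+ #|X| = g ^+ #|X| * 1 by rewrite mulr1.
apply: (@le_trans _ _ (g ^+ #|X| * ((1 - p) / g + p * (1 - a) / g ^+ (2 * d)))); last first.
  by rewrite ler_wpM2l // exprn_ge0 // ltW.
have -> : g ^+ #|X| * ((1 - p) / g + p * (1 - a) / g ^+ (2 * d)) =
  p * ((1 - a) * (g ^+ #|X| / g ^+ (2 * d))) + (1 - p) * (g ^+ #|X| / g) by ring.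
by apply: lerD; apply: ler_wpM2l => //; rewrite subr_ge0.
Qed.
End Crossing.

(** * Attaching vertices to two disjoint classes of the cube *)

Section Attachment.
Variables (d t : nat) (A0 B0 U : {set hvert d}).
Notation V := (hvert d).
Notation E := (hedges d).
Hypotheses (AB0 : [disjoint A0 & B0]) (AU0 : [disjoint A0 & U]) (BU0 : [disjoint B0 & U]).

Definition endsA : {set V} := A0 :|:
  [set v in ~: (U :|: A0 :|: B0) | (t <= #|nb v :&: A0|)%N].
Definition endsB : {set V} := B0 :|:
  [set v in ~: (U :|: A0 :|: B0) | (v \notin endsA) && (t <= #|nb v :&: B0|)%N].
Definition core (v : V) : {set V} := if v \in endsA then A0 else B0.
Definition spokes (v : V) : {set {set V}} :=
  if v \in A0 :|: B0 then set0 else [set [set v; w] | w in nb v :&: core v].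
Definition attached (v : V) (H : {set {set V}}) : bool :=
  (v \in A0 :|: B0) || ~~ [disjoint spokes v & H].
Definition crossing : {set V * V} := [set u in setX endsA endsB | hadj u.1 u.2].

Lemma endsAB : [disjoint endsA & endsB].
Proof.
rewrite disjoints_subset; apply/subsetP => v vA; rewrite inE; apply/negP.
rewrite inE => /orP[vB|]; last by rewrite inE vA andbF.
move: vA; rewrite inE (disjointFl AB0 vB) /= !inE vB /=.
by rewrite !orbT.
Qed.

Lemma attached_spokes v H : attached v H = attached v (H :&: spokes v).
Proof.
rewrite /attached; congr (_ || ~~ _).
by rewrite -!setI_eq0 [H :&: _]setIC setIA setIid.
Qed.

Lemma core_sub v : core v \subset A0 :|: B0.
Proof. by rewrite /core; case: ifP => _; rewrite ?subsetUl ?subsetUr. Qed.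

(** A spoke has its outer end in [A0 :|: B0] and its centre outside, so the edge determines the
    centre. *)
Lemma spokes_disjoint u v : u != v -> [disjoint spokes u & spokes v].
Proof.
move=> uv; rewrite -setI_eq0; apply/eqP/setP => e; rewrite in_set0 inE /spokes.
case: ifPn => [_|uAB]; first by rewrite inE.
case: ifPn => [_|vAB]; first by rewrite inE andbF.
apply/negP => /andP[/imsetP[w _ ->] /imsetP[w' /setIP[_ w'c] Ew]].
have : u \in [set v; w'] by rewrite -Ew set21.
case/set2P => [uE|uE]; first by rewrite uE eqxx in uv.
by move: uAB; rewrite uE (subsetP (core_sub v)).
Qed.

Lemma spokes_edges v : spokes v \subset E.
Proof.
rewrite /spokes; case: ifP => _; first exact: sub0set.
by apply/subsetP => _ /imsetP[w /setIP[+ _] ->]; rewrite inE in_hedges.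
Qed.

Lemma card_spokes v : v \in endsA :|: endsB -> v \notin A0 :|: B0 -> (t <= #|spokes v|)%N.
Proof.
move=> vE vAB; rewrite /spokes (negPf vAB) card_in_imset; last first.
  move=> w w' /setIP[+ _] _ Ew; rewrite inE => vw.
  have : w \in [set v; w'] by rewrite -Ew set22.
  by case/set2P => // wv; rewrite wv hadjxx in vw.
move: vAB; rewrite inE negb_or => /andP[vA vB].
rewrite /core; case: ifPn => vEA.
  by move: vEA; rewrite in_setU (negPf vA) /= inE => /andP[].
by move: vE; rewrite in_setU (negPf vEA) /= in_setU (negPf vB) /= inE => /and3P[].
Qed.

Lemma attached_core v H : attached v H -> v \in A0 :|: B0 \/ exists2 w, w \in core v & adj H v w.
Proof.
rewrite /attached /spokes; case: ifP => [|_] /=; first by left.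
move=> /pred0Pn[_ /andP[/= /imsetP[w /setIP[_ wc] ->] vw]].
by right; exists w.
Qed.

Lemma attachedA v H : v \in endsA -> attached v H -> v \in A0 \/ exists2 w, w \in A0 & adj H v w.
Proof.
move=> vA /attached_core[|]; last by rewrite /core vA; right.
rewrite in_setU => /orP[|vB]; first by left.
have vEB : v \in endsB by rewrite in_setU vB.
by rewrite (disjointFr endsAB vA) in vEB.
Qed.

Lemma attachedB v H : v \in endsB -> attached v H -> v \in B0 \/ exists2 w, w \in B0 & adj H v w.
Proof.
move=> vB /attached_core[|]; last by rewrite /core (disjointFl endsAB vB); right.
rewrite in_setU => /orP[vA|]; last by left.
have vEA : v \in endsA by rewrite in_setU vA.
by rewrite (disjointFr endsAB vEA) in vB.
Qed.

Lemma ends_avoid v : v \in endsA :|: endsB -> v \notin U.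
Proof.
rewrite !inE; case vU : (v \in U) => //=; rewrite ?andbF ?orbF.
by case/orP => h; [rewrite (disjointFr AU0 h) in vU|rewrite (disjointFr BU0 h) in vU].
Qed.

(** An end lies in its class already or has at least [t] spokes, and spokes of distinct vertices are
    disjoint; hence the value [(1 - (1 - q) ^+ t) ^+ 2] for the [a] of [no_crossing_prob]. *)
Lemma no_crossing_attached (R : realFieldType) (p q g : R) :
  0 <= p <= 1 -> 0 <= q <= 1 -> 0 < g -> g <= 1 ->
  (1 - p) / g + p * (1 - (1 - (1 - q) ^+ t) ^+ 2) / g ^+ (2 * d) <= 1 ->
  EX p E (fun G => EX q E (fun H =>
    (no_crossing (fun u => [set u.1; u.2]) attached crossing G H)%:R)) <= g ^+ #|crossing|.
Proof.
move=> p01 q01 g0 g1 step; have /andP[q0 q1] := q01.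
have subX : crossing \subset setX endsA endsB by apply/subsetP => u; rewrite inE => /andP[].
have att_prob v : v \in endsA :|: endsB ->
    1 - (1 - q) ^+ t <= EX q E (fun H => (attached v H)%:R).
  move=> vE; have [vAB|vAB] := boolP (v \in A0 :|: B0).
    rewrite /attached vAB /= EX_cst gerBl exprn_ge0 // subr_ge0 //.
  have -> : EX q E (fun H => (attached v H)%:R) =
            1 - EX q E (fun H => [disjoint spokes v & H]%:R).
    rewrite -mulN1r -EXZ -[X in X + _](EX_cst q E) -EXD; apply: eq_EX => H _.
    by rewrite /attached (negPf vAB); case: [disjoint _ & _]; rewrite /= ?mulr1 ?subrr ?mulr0 ?addr0.
  rewrite EX_avoid ?spokes_edges // lerD2l lerN2 ler_wiXn2l ?card_spokes ?subr_ge0 //.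
  by rewrite gerBl.
apply: (no_crossing_prob p01 q01 g0 g1 step endsAB attached_spokes) => //.
- by move=> u v _ _; apply: spokes_disjoint.
- move=> u v /(subsetP subX); rewrite inE => /andP[u1 u2] /(subsetP subX); rewrite inE => /andP[v1 v2] EQ.
  have h1 : u.1 = v.1.
    have : u.1 \in [set v.1; v.2] by rewrite -EQ set21.
    by case/set2P => // E1; rewrite E1 (disjointFl endsAB v2) in u1.
  have h2 : u.2 = v.2.
    have : u.2 \in [set v.1; v.2] by rewrite -EQ set22.
    by case/set2P => // E1; rewrite E1 (disjointFr endsAB v1) in u2.
  by rewrite (surjective_pairing u) (surjective_pairing v) h1 h2.
- by move=> u; rewrite inE in_hedges => /andP[].
- move=> u /(subsetP subX); rewrite inE => /andP[u1 u2].
  have u12 : u.2 != u.1 by apply: contraTneq u2 => ->; rewrite (disjointFr endsAB u1).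
  have -> : EX q E (fun H => (attached u.1 H && attached u.2 H)%:R) =
      EX q E (fun H => (attached u.1 H)%:R * (attached u.2 H)%:R).
    by apply: eq_EX => H _; rewrite -natrM mulnb.
  rewrite (EX_indep _ _ (F := spokes u.1)) => [|H|H].
  + have uE1 : u.1 \in endsA :|: endsB by rewrite in_setU u1.
    have uE2 : u.2 \in endsA :|: endsB by rewrite in_setU u2 orbT.
    rewrite expr2; apply: ler_pM; rewrite ?att_prob //.
      by rewrite subr_ge0 exprn_ile1 ?subr_ge0 // gerBl.
    by rewrite subr_ge0 exprn_ile1 ?subr_ge0 // gerBl.
  + by congr (_%:R); congr nat_of_bool; apply: attached_spokes.
  + congr (_%:R); congr nat_of_bool; rewrite attached_spokes [RHS]attached_spokes setIDAC; congr attached.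
    by apply/esym/setDidPl; apply: disjointWl (subsetIr _ _) (spokes_disjoint u12).
- move=> x; rewrite -[X in (_ <= X)%N](card_nb x).
  have inj : {in [set u in crossing | u.1 == x] &, injective (@snd V V)}.
    by move=> [a b] [a' b']; rewrite !inE /= => /andP[_ /eqP ->] /andP[_ /eqP ->] ->.
  rewrite -(card_in_imset inj); apply: subset_leq_card; apply/subsetP => z /imsetP[[a b] + ->].
  by rewrite !inE /= => /andP[/andP[_ ab] /eqP <-].
- move=> x; rewrite -[X in (_ <= X)%N](card_nb x).
  have inj : {in [set u in crossing | u.2 == x] &, injective (@fst V V)}.
    by move=> [a b] [a' b']; rewrite !inE /= => /andP[_ /eqP ->] /andP[_ /eqP ->] ->.
  rewrite -(card_in_imset inj); apply: subset_leq_card; apply/subsetP => z /imsetP[[a b] + ->].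
  by rewrite !inE /= hadj_sym => /andP[/andP[_ ab] /eqP <-].
Qed.

(** Isoperimetry for [endsA]: an edge leaving it ends in [endsB] or in one of the remaining
    vertices, each of degree [d]. *)
Lemma crossing_card : 
  (#|A0| * #|B0| <= 2 ^ d * (#|crossing| + d * #|~: (endsA :|: endsB)|))%N.
Proof.
have sB : endsB \subset ~: endsA by rewrite subsetC -disjoints_subset endsAB.
apply: (@leq_trans (#|endsA| * #|~: endsA|)%N).
  apply: leq_mul; first by apply: subset_leq_card; apply: subsetUl.
  by apply: subset_leq_card; apply: subset_trans sB; apply: subsetUl.
apply: leq_trans (edge_boundary _) _; rewrite leq_mul2l; apply/orP; right.
have -> : #|crossing| = (\sum_(x in endsA) #|nb x :&: endsB|)%N.
  transitivity (\sum_(x in endsA) \sum_(y in endsB) hadj x y)%N; last first.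
    by apply: eq_bigr => x _; rewrite card_nbI.
  rewrite pair_big /= -sum1_card big_mkcond [RHS]big_mkcond; apply: eq_bigr => -[x y] _.
  by rewrite in_set in_setX /=; case: (x \in endsA) => //=; case: (y \in endsB) => //=; case: hadj.
apply: (@leq_trans (\sum_(x in endsA) (#|nb x :&: endsB| + #|nb x :&: ~: (endsA :|: endsB)|))%N).
  apply: leq_sum => x _; apply: leq_trans (leq_card_setU _ _); apply: subset_leq_card.
  move: (nb x) endsA endsB => S EA EB; apply/subsetP => y; rewrite !inE.
  by case: (y \in EA) => //= ->; case: (y \in EB).
rewrite big_split leq_add2l sum_nbIC mulnC -sum_nat_const; apply: leq_sum => x _.
by rewrite -[X in (_ <= X)%N](card_nb x) subset_leq_card // subsetIl.
Qed.

(** A vertex outside [U] on neither side has fewer than [t] neighbours in each class; if it has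
    [4 * t] in [W], at least [2 * t] of them lie in the leftover of [W], and double counting limits
    such vertices. *)
Lemma rest_card (W : {set V}) : A0 :|: B0 \subset W ->
  (2 * t * #|~: (endsA :|: endsB)| <=
   2 * t * (#|U| + #|[set v | #|nb v :&: W| < 4 * t]|) + d * #|W :\: (A0 :|: B0)|)%N.
Proof.
clear AB0 AU0 BU0; move=> sW; set Bad := [set v | _]; set Z := W :\: _.
pose Q := [set v : V | (2 * t <= #|nb v :&: Z|)%N].
have sub : ~: (endsA :|: endsB) \subset U :|: Bad :|: Q.
  apply/subsetP => v; rewrite (in_setC v) (in_setU v endsA) negb_or => /andP[vA vB].
  rewrite (in_setU v _ Q) (in_setU v U) [v \in Bad]inE [v \in Q]inE.
  have [//|vU] := boolP (v \in U); rewrite /=.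
  case: ltnP => //= vW.
  have [vA0 vB0] : v \notin A0 /\ v \notin B0.
    by split; [apply: contra vA|apply: contra vB] => h; rewrite in_setU h.
  have fr : v \in ~: (U :|: A0 :|: B0) by rewrite in_setC !in_setU !negb_or vU vA0.
  have hA : (#|nb v :&: A0| < t)%N.
    by rewrite ltnNge; apply: contra vA => h; rewrite in_setU in_set fr h orbT.
  have hB : (#|nb v :&: B0| < t)%N.
    by rewrite ltnNge; apply: contra vB => h; rewrite in_setU in_set fr vA h orbT.
  have splitW : (#|nb v :&: W| <= #|nb v :&: A0| + #|nb v :&: B0| + #|nb v :&: Z|)%N.
    have s : nb v :&: W \subset ((nb v :&: A0) :|: (nb v :&: B0)) :|: (nb v :&: Z).
      by apply/subsetP => y; rewrite !inE => /andP[-> ->]; case: (y \in A0); case: (y \in B0).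
    apply: leq_trans (subset_leq_card s) _; apply: leq_trans (leq_card_setU _ _) _.
    by rewrite leq_add2r leq_card_setU.
  have := leq_trans vW splitW; move: hA hB.
  by move: #|nb v :&: A0| #|nb v :&: B0| #|nb v :&: Z| => x y z; lia.
have hQ : (2 * t * #|Q| <= d * #|Z|)%N.
  rewrite mulnC -sum_nat_const; apply: (@leq_trans (\sum_(v in Q) #|nb v :&: Z|)%N).
    by apply: leq_sum => v; rewrite inE.
  rewrite sum_nbIC mulnC -sum_nat_const; apply: leq_sum => x _.
  by rewrite -[X in (_ <= X)%N](card_nb x) subset_leq_card // subsetIl.
apply: (@leq_trans (2 * t * (#|U| + #|Bad| + #|Q|))%N); last by rewrite mulnDr leq_add2l.
rewrite leq_mul2l; apply/orP; right; apply: leq_trans (subset_leq_card sub) _.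
apply: leq_trans (leq_card_setU _ _) _; rewrite leq_add2r; exact: leq_card_setU.
Qed.

End Attachment.

(** * Union bound over separators *)

Section Separation.
Local Open Scope nat_scope.
Variables (V : finType).
Implicit Types (G H : {set {set V}}) (U W S : {set V}).

Lemma large_component G K x : x \in large G K -> K <= #|component G (large G K) x|.
Proof.
move=> xL; have := xL; rewrite inE => xK; apply: leq_trans xK (subset_leq_card _).
have av z : z \in component G setT x -> z \in large G K.
  by move=> xz; rewrite inE (component_eq xz); rewrite inE in xL.
have := @component_avoid _ G setT (~: large G K) x; rewrite setTD setCK; apply.
by move=> z /av; rewrite in_setC negbK.
Qed.

Definition haven_holds G W (m : nat) : bool :=
  [forall U : {set V}, (#|U| <= m) ==> [exists x, (x \notin U) &&
     (#|W| < 2 * #|W :&: component G (~: U) x|)]].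

Lemma haven_holds_cycle G W m : 1 < m -> haven_holds G W m ->
  exists s, [/\ m < size s, uniq s & cycle (adj G) s].
Proof.
move=> m1 /forallP hv; apply: (haven_cycle (W := W)) => // U Um.
by have := hv U; rewrite Um => /existsP[x /andP[xU big]]; exists x.
Qed.

Definition untouched (P : {set {set V}}) U : {set V} :=
  cover [set S in P | [disjoint S & U]].

Lemma untouchedC P U : untouched P U \subset ~: U.
Proof. by apply/bigcupsP => S; rewrite inE -disjoints_subset => /andP[]. Qed.

Lemma untouched_sub P U : untouched P U \subset cover P.
Proof. by apply/bigcupsP => S; rewrite inE => /andP[SP _]; apply: bigcup_sup. Qed.

(** A vertex of [U] spoils only its own block; [pblock] is empty off the cover. *)
Lemma touched_card P U L : trivIset P -> (forall S, S \in P -> #|S| <= L) ->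
  #|cover P :\: untouched P U| <= #|U| * L.
Proof.
move=> trP szP; apply: (@leq_trans #|\bigcup_(u in U) pblock P u|).
  apply: subset_leq_card; apply/subsetP => x /setDP[/bigcupP[S SP xS] xu].
  have /pred0Pn[u /andP[/= uS uU]] : ~~ [disjoint S & U].
    by apply: contra xu => dSU; apply/bigcupP; exists S; rewrite // inE SP.
  by apply/bigcupP; exists u; rewrite // (def_pblock trP SP uS).
apply: (@leq_trans (\sum_(u in U) #|pblock P u|)).
  apply: (big_ind2 (fun (A : {set V}) n => #|A| <= n)) => [|A1 n1 A2 n2 h1 h2|//].
    by rewrite cards0.
  exact: leq_trans (leq_card_setU A1 A2) (leq_add h1 h2).
rewrite -sum_nat_const; apply: leq_sum => u _.
have [uP|uP] := boolP (u \in cover P); first by rewrite szP // pblock_mem.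
rewrite /pblock; case: pickP => [S /andP[SP uS]|_]; last by rewrite cards0.
by case/negP: uP; apply/bigcupP; exists S.
Qed.

(** Equivalently, [S] is a union of components of [G - U]. *)
Definition closed_off G U S :=
  (S \subset ~: U) && [forall x in S, forall y, (y \notin U) && adj G x y ==> (y \in S)].

Lemma closed_offP G U S x y : closed_off G U S ->
  x \in S -> y \notin U -> adj G x y -> y \in S.
Proof.
move=> /andP[_ /forallP h] xS yU xy; have := h x; rewrite xS => /forallP/(_ y).
by rewrite yU xy.
Qed.

(* A minimal closed set carrying an eighth of [W0] consists, up to less than an
   eighth, of one component. *)
Lemma separation G W W0 U : W0 \subset W -> W0 \subset ~: U -> 0 < #|W| ->
  8 * #|W :\: W0| <= #|W| ->
  (forall x, x \notin U -> 2 * #|W :&: component G (~: U) x| <= #|W|) ->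
  exists S, [/\ closed_off G U S, #|W| <= 8 * #|W0 :&: S| & #|W| <= 8 * #|W0 :\: S|].
Proof.
move=> W0W W0U W_gt0 touched nobig.
pose Q S := closed_off G U S && (#|W| <= 8 * #|W0 :&: S|).
case: (boolP [exists S, Q S && (#|W| <= 8 * #|W0 :\: S|)]).
  by move=> /existsP[S /andP[/andP[clS h1] h2]]; exists S.
move=> /existsPn noS; exfalso.
have cardW : #|W0| + #|W :\: W0| = #|W| by rewrite -(cardsID W0 W) (setIidPr W0W).
have QU : Q (~: U).
  apply/andP; split; last by rewrite (setIidPl W0U); lia.
  rewrite /closed_off subxx; apply/forallP => x; apply/implyP => _.
  by apply/forallP => y; apply/implyP => /andP[yU _]; rewrite in_setC.
case: (arg_minnP (fun S : {set V} => #|S|) QU) => S QS minS.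
have := noS S; rewrite QS /= -ltnNge => outS.
have /andP[clS inS] := QS; have SU : S \subset ~: U by case/andP: clS.
have [x xS] : exists x, x \in S.
  apply/set0Pn; apply: contraTneq inS => ->; rewrite setI0 cards0; lia.
have xU : x \notin U by have := subsetP SU x xS; rewrite inE.
set C := component G (~: U) x.
have clD : closed_off G U (S :\: C).
  rewrite /closed_off (subset_trans (subsetDl _ _) SU) /=; apply/forallP => y; apply/implyP.
  move=> /setDP[yS yC]; apply/forallP => z; apply/implyP => /andP[zU yz].
  rewrite in_setD (closed_offP clS yS zU yz) andbT; apply: contra yC => zC.
  apply: component_adj zC _; rewrite /adj_in adj_sym yz !in_setC zU /= andbT.
  by have := subsetP SU y yS; rewrite in_setC.
have smallD : 8 * #|W0 :&: (S :\: C)| < #|W|.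
  rewrite ltnNge; apply/negP => h; have := minS (S :\: C); rewrite /Q clD h => /(_ isT).
  by rewrite leqNgt => /negP; apply; apply: proper_card; apply/properP;
    split; [exact: subsetDl|exists x; rewrite // in_setD component_refl].
have card1 : #|W0 :&: S| + #|W0 :\: S| = #|W0| by rewrite cardsID.
have card2 : #|W0 :&: S| <= #|W0 :&: C| + #|W0 :&: (S :\: C)|.
  apply: leq_trans (leq_card_setU _ _); apply: subset_leq_card.
  by apply/subsetP => y; rewrite -setIUr !in_setI => /andP[-> yS]; rewrite in_setU in_setD yS andbT orbN.
have card3 : #|W0 :&: C| <= #|W :&: C| by apply: subset_leq_card; apply: setSI.
(* Shares of [W]: at most 1/2 in [C], less than 1/8 in each of [S :\: C] and [W0 :\: S], at most 1/8
   outside [W0]. Their total is below 1. *)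
have := nobig x xU; rewrite -/C; move: card1 card2 card3 smallD cardW outS touched W_gt0.
move: #|W0 :&: S| #|W0 :\: S| #|W0| #|W0 :&: C| #|W0 :&: (S :\: C)| #|W| #|W :&: C| #|W :\: W0|.
by clear; move=> a b c e f w h z; lia.
Qed.

End Separation.

Section UnionBound.
Variables (R : realFieldType) (d t K m x0 : nat) (p q g : R).
Notation V := (hvert d).
Notation E := (hedges d).
Variable G1 : {set {set V}}.
Notation W := (large G1 K).
Hypotheses (p01 : 0 <= p <= 1) (q01 : 0 <= q <= 1) (g_gt0 : 0 < g) (g_le1 : g <= 1).
Hypothesis step : (1 - p) / g + p * (1 - (1 - (1 - q) ^+ t) ^+ 2) / g ^+ (2 * d) <= 1.
Hypotheses (G1E : G1 \subset E) (K_gt0 : (0 < K)%N) (W_gt0 : (0 < #|W|)%N).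
Hypothesis m_small : (8 * (m * (d.+2 * K)) <= #|W|)%N.
Hypothesis many_crossings : forall A0 B0 U : {set V}, [disjoint A0 & B0] ->
  A0 :|: B0 \subset W -> (#|U| <= m)%N ->
  (#|W| <= 8 * #|A0|)%N -> (#|W| <= 8 * #|B0|)%N ->
  (#|W :\: (A0 :|: B0)| <= m * (d.+2 * K))%N -> (x0 <= #|crossing t A0 B0 U|)%N.

(** If the haven fails at [U], [separation] yields a balanced closed set [S]. A connected piece
    missing [U] is inside [S] or disjoint from it, so [S] induces one of at most [2 ^ (2 ^ d / K)]
    colourings, and no crossing between the colours succeeds. *)
Lemma haven_failure_prob :
  EX p E (fun G2 => EX q E (fun G3 => (~~ haven_holds (G1 :|: G2 :|: G3) W m)%:R)) <=
  #|[set U : {set V} | (#|U| <= m)%N]|%:R * 2 ^+ (2 ^ d %/ K) * g ^+ x0.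
Proof.
have [P [pP szP]] := @split_pieces _ G1 d (fun x => adj_degree x G1E) W K K_gt0
  (@large_component _ G1 K).
have /and3P[/eqP covP trP P0] := pP.
have cardP : (#|P| <= 2 ^ d %/ K)%N.
  rewrite leq_divRL //; apply: (@leq_trans #|W|); last first.
    by rewrite (leq_trans (max_card _)) // card_ffun card_bool card_ord.
  rewrite (card_partition pP) -sum_nat_const; apply: leq_sum => S SP.
  by have [_ /andP[]] := szP S SP.
pose A0 U (Q : {set {set V}}) := untouched (P :&: Q) U.
pose B0 U (Q : {set {set V}}) := untouched (P :\: Q) U.
pose cond U Q := (#|W| <= 8 * #|A0 U Q|)%N && (#|W| <= 8 * #|B0 U Q|)%N.
pose ed (u : V * V) : {set V} := [set u.1; u.2].
pose bad U Q G2 G3 := no_crossing ed (attached t (A0 U Q) (B0 U Q) U)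
  (crossing t (A0 U Q) (B0 U Q) U) G2 G3.
have disAB U Q : [disjoint A0 U Q & B0 U Q].
  rewrite -setI_eq0; apply/eqP/setP => x; rewrite in_set0 in_setI; apply/negP.
  move=> /andP[/bigcupP[S + xS] /bigcupP[S' + xS']].
  rewrite !inE => /andP[/andP[SP SQ] _] /andP[/andP[nSQ SP'] _].
  have := def_pblock trP SP xS; rewrite (def_pblock trP SP' xS') => E'.
  by rewrite -E' (negPf nSQ) in SQ.
have AB_U U Q : A0 U Q :|: B0 U Q = untouched P U.
  rewrite /A0 /B0 /untouched /cover -bigcup_setU; apply: eq_bigl => S.
  by rewrite !inE; case: (S \in P); case: (S \in Q); case: [disjoint S & U].
have det G2 G3 : ~~ haven_holds (G1 :|: G2 :|: G3) W m ->
    exists (U : {set V}) (Q : {set {set V}}), (#|U| <= m)%N && (Q \subset P) /\ cond U Q && bad U Q G2 G3.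
  move=> /forallPn[U]; rewrite negb_imply => /andP[Um /existsPn nobig].
  set G := G1 :|: G2 :|: G3 in nobig.
  have W0W : untouched P U \subset W by rewrite -covP untouched_sub.
  have tc : (#|W :\: untouched P U| <= m * (d.+2 * K))%N.
    rewrite -{1}covP; apply: leq_trans (touched_card U trP _) _.
      by move=> S SP; have [_ /andP[_ h]] := szP S SP; exact: h.
    by rewrite leq_mul2r Um orbT.
  have [||S [clS hA hB]] := @separation _ G W (untouched P U) U W0W (untouchedC _ _) W_gt0.
  - by apply: leq_trans m_small; rewrite leq_mul2l tc.
  - by move=> x xU; have := nobig x; rewrite xU /= -leqNgt.
  have SU : S \subset ~: U by case/andP: clS.
  pose Q := [set S' in P | S' \subset S].
  have AS : A0 U Q \subset S.
    by apply/bigcupsP => S'; rewrite !inE => /andP[/andP[_ /andP[_ ->]] _].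
  have BS x : x \in B0 U Q -> x \notin S.
    move=> /bigcupP[S']; rewrite !inE => /andP[/andP[nS' S'P] dU] xS'.
    rewrite S'P /= in nS'; apply: contra nS' => xS.
    have [cS' _] := szP S' S'P; rewrite -(connected_component cS' xS').
    apply: component_min => // a b aS /and3P[_ bS' ab]; apply: closed_offP clS aS _ _.
      by rewrite (disjointFr dU bS').
    by rewrite /adj /G !inE -/(adj G1 a b) ab.
  exists U, Q; split; first by rewrite Um; apply/subsetP => S'; rewrite inE => /andP[].
  apply/andP; split.
    apply/andP; split; [apply: leq_trans hA _|apply: leq_trans hB _]; rewrite leq_mul2l;
      apply: subset_leq_card; apply/subsetP => x.
      move=> /setIP[]; rewrite -(AB_U U Q) in_setU => /orP[//|/BS/negPf ->//].
    move=> /setDP[]; rewrite -(AB_U U Q) in_setU => /orP[/(subsetP AS) ->//|//].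
  apply/forallP => u; apply/implyP; rewrite in_set [u in u \in setX _ _]surjective_pairing in_setX => /andP[/andP[u1 u2] _].
  have AU : [disjoint A0 U Q & U] by rewrite disjoints_subset untouchedC.
  have BU : [disjoint B0 U Q & U] by rewrite disjoints_subset untouchedC.
  apply/negP => /and3P[e2 /(attachedA (disAB U Q) u1) a1 /(attachedB (disAB U Q) u2) a2].
  have u1U : u.1 \notin U by apply: (ends_avoid AU BU (t := t)); rewrite in_setU u1.
  have u2U : u.2 \notin U by apply: (ends_avoid AU BU (t := t)); rewrite in_setU u2 orbT.
  have G3G x y : adj G3 x y -> adj G x y by rewrite /adj /G [in X in _ -> X]inE => ->; rewrite orbT.
  (* A successful crossing would lead from [A0] inside [S] to [B0] outside [S] without meeting
     [U]. *)
  have u1S : u.1 \in S.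
    case: a1 => [/(subsetP AS)//|[w /(subsetP AS) wS /G3G xw]].
    by apply: (closed_offP clS wS u1U); rewrite adj_sym.
  have u2S : u.2 \in S.
    by apply: (closed_offP clS u1S u2U); rewrite /adj /G !inE e2 orbT.
  case: a2 => [/BS|[w wB /G3G xw]]; first by rewrite u2S.
  by have /negP := BS w wB; apply; apply: (closed_offP clS u2S _ xw); rewrite (disjointFr BU wB).
have /andP[p0 p1] := p01; have /andP[q0 q1] := q01.
(* Unbalanced colourings get weight 0: [separation] never produces them, and [many_crossings] does
   not cover them. *)
pose F G2 G3 : R := \sum_(U in [set U : {set V} | (#|U| <= m)%N])
  \sum_(Q in powerset P) (if cond U Q then (bad U Q G2 G3)%:R else 0).
have F_ge0 G2 G3 (U : {set V}) : 0 <= \sum_(Q in powerset P) (if cond U Q then (bad U Q G2 G3)%:R else 0) :> R.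
  by apply: sumr_ge0 => Q _; case: ifP => // _; rewrite ler0n.
apply: (@le_trans _ _ (EX p E (fun G2 => EX q E (F G2)))).
  apply: le_EX => // G2 _; apply: le_EX => // G3 _.
  case: (boolP (haven_holds _ _ _)) => [_|/det[U [Q [/andP[Um sQ] /andP[cUQ bUQ]]]]] /=.
    by apply: sumr_ge0.
  rewrite /F (bigD1 U) ?inE //= (bigD1 Q) ?powersetE //= cUQ bUQ -addrA.
  rewrite lerDl addr_ge0 //; apply: sumr_ge0 => // Q' _.
  by case: ifP => // _; rewrite ler0n.
under eq_EX => G2 _ do rewrite EX_sum.
rewrite EX_sum; apply: (@le_trans _ _
  (\sum_(U in [set U : {set V} | (#|U| <= m)%N]) \sum_(Q in powerset P) g ^+ x0)); last first.
  rewrite sumr_const -[X in X <= _]mulr_natl -mulrA ler_wpM2l ?ler0n //.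
  rewrite sumr_const -[X in X <= _]mulr_natl ler_wpM2r ?exprn_ge0 ?(ltW g_gt0) //.
  by rewrite card_powerset natrX ler_weXn2l ?ler1n.
apply: ler_sum => U; rewrite inE => Um.
under eq_EX => G2 _ do rewrite EX_sum.
rewrite EX_sum; apply: ler_sum => Q _; case cUQ: (cond U Q); last first.
  rewrite (_ : EX _ _ _ = 0) ?exprn_ge0 ?(ltW g_gt0) // -[RHS](EX_cst p E).
  by apply: eq_EX => G2 _; rewrite EX_cst.
have AU : [disjoint A0 U Q & U] by rewrite disjoints_subset untouchedC.
have BU : [disjoint B0 U Q & U] by rewrite disjoints_subset untouchedC.
apply: le_trans (no_crossing_attached _ (disAB U Q) p01 q01 g_gt0 g_le1 step) _.
apply: ler_wiXn2l; rewrite ?(ltW g_gt0) //; have /andP[cA cB] := cUQ.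
apply: many_crossings => //; rewrite AB_U -covP ?untouched_sub //.
apply: leq_trans (touched_card (L := d.+2 * K) U trP _) _; last by rewrite leq_mul2r Um orbT.
by move=> S SP; have [_ /andP[_ h]] := szP S SP; exact: h.
Qed.
End UnionBound.

(** * Numerical estimates *)

Section Estimates.
Local Open Scope nat_scope.

(** Bound [d ^ (k + 1)] by a constant times [2 ^ (d / a)]; the spare factor [d] absorbs that
    constant and [M]. *)
Lemma poly_leq_exp2 a k M : 0 < a ->
  exists D, forall d, D <= d -> M * d ^ k <= 2 ^ (d %/ a).
Proof.
move=> a0; pose j := k.+1; exists (M * (2 * (a * j)) ^ j + a * j) => d hd.
have aj0 : 0 < a * j by rewrite muln_gt0 a0.
have j0 : 0 < j by [].
set e := d %/ (a * j).
have d_le : d <= 2 * (a * j) * 2 ^ e.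
  have h1 : d < (a * j) * e.+1 by rewrite mulnC ltn_ceil.
  have h2 : e.+1 <= 2 ^ e by apply: ltn_expl.
  have : a * j * e.+1 <= a * j * 2 ^ e by rewrite leq_mul2l h2 orbT.
  nia.
have ej : e * j <= d %/ a.
  by rewrite leq_divRL // -mulnA [j * a]mulnC leq_divM.
have main : d ^ j <= (2 * (a * j)) ^ j * 2 ^ (d %/ a).
  apply: (@leq_trans ((2 * (a * j) * 2 ^ e) ^ j)); first by rewrite leq_exp2r.
  by rewrite expnMn leq_mul2l -expnM leq_exp2l // ej orbT.
have c0 : 0 < (2 * (a * j)) ^ j by rewrite expn_gt0 muln_gt0 aj0.
rewrite -(leq_pmul2l c0); apply: leq_trans main.
rewrite [d ^ j]expnS mulnA leq_mul2r mulnC; apply/orP; right.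
by apply: leq_trans hd; rewrite leq_addr.
Qed.

(** Both classes have order at least [n / (8 a)], so [n <= 64 a ^ 2 (cr + d r)]. The term with [r]
    takes at most [n / 2]: one quarter of [n] is allowed for [bad], one for [u] and [z] together. *)
Lemma crossing_estimate n d t a Ck m w u bad z cA cB cr r :
  0 < n -> 0 < t -> 0 < d -> d <= 2 * a * t -> n <= a * w -> w <= 8 * cA -> w <= 8 * cB ->
  cA * cB <= n * (cr + d * r) -> 2 * t * r <= 2 * t * (u + bad) + d * z ->
  u <= m -> z <= m * (d.+2 * (Ck * d)) -> d ^ 2 * bad <= n -> 256 * a ^ 2 <= d ->
  m * (256 * a ^ 2 * (1 + 3 * a * Ck) * d ^ 3) <= n -> n %/ (128 * a ^ 2) <= cr.
Proof.
move=> n0 t0 d0 dt nw wA wB cAB hr um hz hbad da hm.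
have nA : n <= 8 * a * cA by nia.
have nB : n <= 8 * a * cB by nia.
have h1 : n <= 64 * a ^ 2 * (cr + d * r).
  rewrite -(leq_pmul2l n0); apply: leq_trans (leq_mul nA nB) _.
  have -> : 8 * a * cA * (8 * a * cB) = 64 * a ^ 2 * (cA * cB) by ring.
  have -> : n * (64 * a ^ 2 * (cr + d * r)) = 64 * a ^ 2 * (n * (cr + d * r)) by ring.
  by rewrite leq_mul2l cAB orbT.
have h2 : r <= u + bad + a * z.
  have t20 : 0 < 2 * t by rewrite muln_gt0.
  rewrite -(leq_pmul2l t20); apply: leq_trans hr _; rewrite (mulnDr _ (u + bad)) leq_add2l.
  have -> : 2 * t * (a * z) = 2 * a * t * z by ring.
  by rewrite leq_mul2r dt orbT.
have hz' : d * z <= m * d ^ 3 * (3 * Ck).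
  apply: (@leq_trans (d * (m * (d.+2 * (Ck * d))))); first by rewrite leq_mul2l hz orbT.
  have -> : m * d ^ 3 * (3 * Ck) = d * (m * (3 * d * (Ck * d))) by ring.
  rewrite !leq_mul2l; apply/orP; right; apply/orP; right; rewrite leq_mul2r.
  by apply/orP; right; move: d0; clear; lia.
have hu : d * u <= m * d ^ 3.
  by rewrite mulnC; apply: leq_mul => //; rewrite -{1}(expn1 d) leq_pexp2l.
have hb : 256 * a ^ 2 * (d * bad) <= n.
  apply: leq_trans hbad; by rewrite -[d ^ 2]mulnn -[d * d * bad]mulnA leq_mul2r da orbT.
have h3 : 256 * a ^ 2 * (d * r) <= 2 * n.
  apply: (@leq_trans (256 * a ^ 2 * (d * u + d * bad + a * (d * z)))).
    rewrite leq_mul2l; apply/orP; right.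
    have -> : d * u + d * bad + a * (d * z) = d * (u + bad + a * z) by ring.
    by rewrite leq_mul2l h2 orbT.
  apply: (@leq_trans (256 * a ^ 2 * (m * d ^ 3 + a * (m * d ^ 3 * (3 * Ck))) + n)).
    have -> : 256 * a ^ 2 * (d * u + d * bad + a * (d * z)) =
       256 * a ^ 2 * (d * u + a * (d * z)) + 256 * a ^ 2 * (d * bad) by ring.
    apply: leq_add => //; rewrite leq_mul2l; apply/orP; right; apply: leq_add => //.
    by rewrite leq_mul2l hz' orbT.
  have -> : 256 * a ^ 2 * (m * d ^ 3 + a * (m * d ^ 3 * (3 * Ck))) =
     m * (256 * a ^ 2 * (1 + 3 * a * Ck) * d ^ 3) by ring.
  by rewrite mul2n -addnn leq_add2r.
have a0 : 0 < a by case: (a) nw n0 => [|//]; rewrite mul0n leqn0 => /eqP ->.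
have c0 : 0 < 128 * a ^ 2 by rewrite muln_gt0 expn_gt0 a0.
have h4 : n <= 128 * a ^ 2 * cr.
  have e1 : 2 * (64 * a ^ 2 * (cr + d * r)) = 128 * a ^ 2 * cr + 128 * a ^ 2 * (d * r) by ring.
  have e2 : 256 * a ^ 2 * (d * r) = 2 * (128 * a ^ 2 * (d * r)) by ring.
  by move: h1 h3 e1 e2; clear; lia.
by rewrite -(mulKn cr c0) leq_div2r.
Qed.
End Estimates.

Section RealEstimates.
Variable R : realType.
Implicit Types (x p q rho g s : R) (n m : nat).

Lemma bernoulli_inequality x n : 0 <= x <= 1 -> 1 - n%:R * x <= (1 - x) ^+ n.
Proof.
move=> /andP[x0 x1]; elim: n => [|n IH]; first by rewrite mul0r subr0 expr0.
rewrite exprS; apply: (@le_trans _ _ ((1 - x) * (1 - n%:R * x))); last first.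
  by rewrite ler_wpM2l // subr_ge0.
have : 0 <= n%:R * x * x by rewrite !mulr_ge0.
by rewrite -natr1; nra.
Qed.

Lemma pow_one_sub_le x n : 0 <= x <= 1 -> (1 - x) ^+ n <= (1 + n%:R * x)^-1.
Proof.
move=> /andP[x0 x1]; have h : 1 + n%:R * x <= (1 + x) ^+ n.
  elim: n => [|n IH]; first by rewrite mul0r addr0 expr0.
  rewrite exprS; apply: (@le_trans _ _ ((1 + x) * (1 + n%:R * x))); last first.
    by rewrite ler_wpM2l // addr_ge0.
  have : 0 <= n%:R * x * x by rewrite !mulr_ge0.
  by rewrite -natr1; nra.
have pos : 0 < 1 + n%:R * x by rewrite ltr_wpDr // mulr_ge0.
have h0 : 0 <= (1 - x) ^+ n by rewrite exprn_ge0 // subr_ge0.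
rewrite -[_^-1]mul1r ler_pdivlMr //; apply: le_trans (ler_wpM2l h0 h) _.
rewrite -exprMn exprn_ile1 //; nra.
Qed.

Lemma geometric_small x (M : R) : 0 < x <= 1 -> exists n, M * (1 - x) ^+ n <= 1.
Proof.
move=> /andP[x0 x1]; exists (Num.bound (`|M| / x)).
set n := Num.bound _; have hn : `|M| / x < n%:R by apply: archi_boundP; rewrite divr_ge0 // ltW.
have {}hn : `|M| <= n%:R * x by rewrite -ler_pdivrMr // ltW.
have x01 : 0 <= x <= 1 by rewrite (ltW x0).
have pos : 0 < 1 + n%:R * x by rewrite ltr_wpDr // mulr_ge0 // ltW.
have h0 : 0 <= (1 - x) ^+ n by rewrite exprn_ge0 // subr_ge0.
apply: (@le_trans _ _ (`|M| * (1 + n%:R * x)^-1)).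
  apply: (@le_trans _ _ (`|M| * (1 - x) ^+ n)); first by rewrite ler_wpM2r // ler_norm.
  by rewrite ler_wpM2l // pow_one_sub_le.
by rewrite ler_pdivrMr // mul1r; lra.
Qed.

(** With [n p] at least [1 / rho], the bound of [pow_one_sub_le] is at most
    [1 / (1 + (1 - rho) / rho)], which is [rho]. *)
Lemma branching_growth p rho n : 0 <= p <= 1 -> 0 < rho <= 1 -> 1 <= rho * (n%:R * p) ->
  (1 - p + p * rho) ^+ n <= rho.
Proof.
move=> /andP[p0 p1] /andP[r0 r1] h.
have y01 : 0 <= p * (1 - rho) <= 1.
  by rewrite mulr_ge0 ?subr_ge0 //= mulr_ile1 ?subr_ge0 // gerBl ltW.
have -> : 1 - p + p * rho = 1 - p * (1 - rho) by ring.
apply: le_trans (pow_one_sub_le n y01) _.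
have pos : 0 < 1 + n%:R * (p * (1 - rho)) by rewrite ltr_wpDr // mulr_ge0 //; case/andP: y01.
rewrite -[_^-1]mul1r ler_pdivrMr //.
have : (1 - rho) * 1 <= (1 - rho) * (rho * (n%:R * p)) by rewrite ler_wpM2l // subr_ge0.
lra.
Qed.

(* [w] is the probability that a given crossing fails to be attached, and
   [1 - s * p] the decay per crossing edge in [no_crossing_prob]. *)
Lemma matching_step p s z w (d : nat) : 0 < p <= 1 -> 0 <= w <= z -> z < 1 ->
  0 < s <= 1 -> s < 1 -> s <= (1 - z) / 2 -> 2 * s * (d%:R * p) <= (1 - z) / (1 + z) ->
  (1 - p) / (1 - s * p) + p * w / (1 - s * p) ^+ (2 * d) <= 1.
Proof.
move=> /andP[p0 p1] /andP[w0 wz] z1 /andP[s0 _] s1 sz sc.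
have z0 : 0 <= z by lra.
have sp : 0 <= s * p <= 1 by rewrite mulr_ge0 ?mulr_ile1 // ltW.
have sp1 : 0 < 1 - s * p by nra.
have e1 : (1 - p) / (1 - s * p) <= 1 - p * (1 - s).
  have : 0 <= s * p * p * (1 - s) by rewrite !mulr_ge0 ?subr_ge0 // ltW.
  by rewrite ler_pdivrMr //; nra.
have zz : 0 < 1 + z by lra.
(* Chosen so that the second quotient is at most [(1 + z) / 2], half-way from [z] to 1; the
   remaining gap [(1 - z) / 2] pays for [s] in [e1]. *)
have b1 : 2 * z / (1 + z) <= (1 - s * p) ^+ (2 * d).
  apply: le_trans (bernoulli_inequality (2 * d) sp).
  have e : 2 * z / (1 + z) = 1 - (1 - z) / (1 + z) by field; lra.
  rewrite e lerD2l lerN2 natrM; apply: le_trans sc; lra.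
have e2 : w / (1 - s * p) ^+ (2 * d) <= (1 + z) / 2.
  have pos : 0 < (1 - s * p) ^+ (2 * d) by rewrite exprn_gt0.
  rewrite ler_pdivrMr //; apply: (le_trans wz).
  apply: (@le_trans _ _ ((1 + z) / 2 * (2 * z / (1 + z)))).
    rewrite le_eqVlt; apply/orP; left; apply/eqP; field; lra.
  by rewrite ler_wpM2l //; lra.
have e3 : p * w / (1 - s * p) ^+ (2 * d) <= p * ((1 + z) / 2).
  by rewrite -mulrA ler_wpM2l // ltW.
have e4 : 0 <= p * ((1 - z) / 2 - s) by rewrite mulr_ge0 ?subr_ge0 // ltW.
lra.
Qed.

(** Each such set has probability at least [p ^+ m * (1 - p) ^+ #|V|] as a Bernoulli subset; this
    avoids binomial coefficients. *)
Lemma card_small_sets (V : finType) p m : 0 <= p <= 1 ->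
  #|[set U : {set V} | (#|U| <= m)%N]|%:R * (p ^+ m * (1 - p) ^+ #|V|) <= 1.
Proof.
move=> /andP[p0 p1]; rewrite -[X in _ <= X](EX_cst p [set: V]).
have -> : #|[set U : {set V} | (#|U| <= m)%N]|%:R * (p ^+ m * (1 - p) ^+ #|V|) =
  \sum_(U : {set V} | (#|U| <= m)%N) p ^+ m * (1 - p) ^+ #|V|.
  by rewrite sumr_const mulr_natl; congr (_ *+ _); apply: eq_card => U; rewrite inE.
rewrite /EX powersetT big_mkcond [X in _ <= X]big_mkcond; apply: ler_sum => U _.
rewrite inE mulr1; case: ifP => Um; last by rewrite mulr_ge0 // exprn_ge0 // subr_ge0.
apply: ler_pM; rewrite ?exprn_ge0 ?subr_ge0 //; first exact: ler_wiXn2l.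
by apply: ler_wiXn2l; rewrite ?subr_ge0 ?gerBl // cardsT leq_subr.
Qed.

End RealEstimates.

(** * Asymptotics *)

Definition sparse (d K t : nat) (G : {set {set hvert d}}) : {set hvert d} :=
  [set v | (#|nb v :&: large G K| < t)%N].

Lemma card_hvert d : #|{: hvert d}| = (2 ^ d)%N.
Proof. by rewrite card_ffun card_bool card_ord. Qed.

Section Rounds.
Variables (R : realType) (d : nat).
Notation V := (hvert d).
Notation E := (hedges d).

Lemma many_sparse_prob (p rho : R) (N k K b t : nat) : 0 <= p <= 1 -> 0 < rho <= 1 ->
  (K <= 2 ^ k)%N -> 1 <= rho * (N%:R * p) -> (N + 2 * k + b <= d)%N ->
  EX p E (fun G => (2 ^ d < d ^ 2 * #|sparse K t G|)%N%:R) <=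
  d%:R ^+ 2 * (2 ^+ t * ((1 + rho) / 2) ^+ b).
Proof.
move=> p01 rho01 leK grow led; have /andP[p0 p1] := p01; have /andP[r0 r1] := rho01.
have n0 : 0 < 2 ^+ d :> R by rewrite exprn_gt0.
apply: (@le_trans _ _ (d%:R ^+ 2 / 2 ^+ d * EX p E (fun G => #|sparse K t G|%:R))).
  rewrite -EXZ; apply: le_EX => // G _; case: ltnP => /= [h|_]; last first.
    by rewrite mulr_ge0 // divr_ge0 ?exprn_ge0.
  rewrite mulrAC ler_pdivlMr // mul1r -!natrX -natrM ler_nat; exact: ltnW.
rewrite -mulrA ler_wpM2l ?exprn_ge0 // mulrC ler_pdivrMr //.
have -> : EX p E (fun G => #|sparse K t G|%:R) =
    \sum_(v : V) EX p E (fun G => (#|nb v :&: large G K| < t)%N%:R).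
  rewrite -EX_sum; apply: eq_EX => G _; rewrite -sum1_card natr_sum big_mkcond /=.
  by apply: eq_bigr => v _; rewrite inE; case: ifP.
apply: (@le_trans _ _ (\sum_(v : V) (2 ^+ t * ((1 + rho) / 2) ^+ b))).
  apply: ler_sum => v _; apply: (few_large_neighbours p0 p1 r0 r1 leK _ _ _ led).
  exact: branching_growth.
by rewrite sumr_const card_hvert -[X in X <= _]mulr_natl natrX mulrC.
Qed.

Lemma large_card (G : {set {set V}}) (K t a : nat) : (2 <= d)%N -> (0 < t)%N ->
  (d <= 2 * a * t)%N -> (d ^ 2 * #|sparse K (4 * t) G| <= 2 ^ d)%N ->
  (2 ^ d <= a * #|large G K|)%N.
Proof.
move=> d2 t0 dt few; set S := sparse K (4 * t) G in few *.
have half : (2 ^ d <= 2 * #|~: S|)%N.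
  have := cardsC S; rewrite card_hvert => cS.
  have : (2 * #|S| <= 2 ^ d)%N.
    apply: leq_trans few; rewrite leq_mul2r; apply/orP; right.
    by apply: (leq_trans d2); rewrite -{1}(expn1 d) leq_pexp2l // ltnW.
  lia.
have h : (4 * t * #|~: S| <= d * #|large G K|)%N.
  rewrite mulnC -sum_nat_const; apply: (@leq_trans (\sum_(v in ~: S) #|nb v :&: large G K|)%N).
    by apply: leq_sum => v; rewrite !inE -leqNgt.
  rewrite sum_nbIC mulnC -sum_nat_const; apply: leq_sum => x _.
  by rewrite -[X in (_ <= X)%N](card_nb x) subset_leq_card // subsetIl.
have t20 : (0 < 2 * t)%N by rewrite muln_gt0.
rewrite -(leq_pmul2l t20); apply: (@leq_trans (d * #|large G K|)).
  apply: leq_trans h; have -> : (4 * t * #|~: S| = 2 * t * (2 * #|~: S|))%N by ring.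
  by rewrite leq_mul2l half orbT.
have -> : (2 * t * (a * #|large G K|) = 2 * a * t * #|large G K|)%N by ring.
by rewrite leq_mul2r dt orbT.
Qed.

Lemma haven_failure_le (G1 : {set {set V}}) (p g : R) (Ck t a m : nat) :
  G1 \subset E -> 0 <= p <= 1 -> 0 < g <= 1 ->
  (1 - p) / g + p * (1 - (1 - (1 - p) ^+ t) ^+ 2) / g ^+ (2 * d) <= 1 ->
  (0 < Ck)%N -> (0 < a)%N -> (0 < t)%N -> (d <= 2 * a * t)%N -> (256 * a ^ 2 <= d)%N ->
  (m * (256 * a ^ 2 * (1 + 3 * a * Ck) * d ^ 3) <= 2 ^ d)%N ->
  (d ^ 2 * #|sparse (Ck * d) (4 * t) G1| <= 2 ^ d)%N ->
  EX p E (fun G2 => EX p E (fun G3 =>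
    (~~ haven_holds (G1 :|: G2 :|: G3) (large G1 (Ck * d)) m)%:R)) <=
  #|[set U : {set V} | (#|U| <= m)%N]|%:R * 2 ^+ (2 ^ d %/ (Ck * d)) *
  g ^+ (2 ^ d %/ (128 * a ^ 2)).
Proof.
move=> G1E p01 /andP[g0 g1] step Ck0 a0 t0 dt da hm few.
have a2 : (0 < a ^ 2)%N by rewrite expn_gt0 a0.
have d2 : (2 <= d)%N by lia.
have d0 : (0 < d)%N by lia.
have WL := large_card d2 t0 dt few.
have n0 : (0 < 2 ^ d)%N by rewrite expn_gt0.
apply: (haven_failure_prob p01 p01 g0 g1 step) => //.
- by rewrite muln_gt0 Ck0.
- by move: WL n0; case: #|_| => //; rewrite muln0 leqn0 => /eqP ->.
- rewrite -(leq_pmul2l a0); apply: leq_trans WL; apply: leq_trans hm.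
  have -> : (a * (8 * (m * (d.+2 * (Ck * d)))) = m * (8 * a * Ck * (d.+2 * d)))%N by ring.
  rewrite leq_mul2l; apply/orP; right.
  have h3 : (d.+2 * d <= 3 * d ^ 3)%N by rewrite !expnS expn0; nia.
  apply: leq_trans (leq_mul (leqnn _) h3) _; rewrite mulnA leq_mul2r; apply/orP; right.
  have -> : (256 * a ^ 2 * (1 + 3 * a * Ck) = 256 * a ^ 2 + 768 * (a ^ 2 * (a * Ck)))%N by ring.
  have : (a * Ck <= a ^ 2 * (a * Ck))%N by rewrite leq_pmull.
  lia.
move=> A0 B0 U AB sW Um WA WB Zm.
apply: (@crossing_estimate (2 ^ d) d t a Ck m #|large G1 (Ck * d)| #|U|
  #|sparse (Ck * d) (4 * t) G1| #|large G1 (Ck * d) :\: (A0 :|: B0)| #|A0| #|B0|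
  _ #|~: (endsA t A0 B0 U :|: endsB t A0 B0 U)|) => //.
- exact: crossing_card.
- exact: rest_card.
Qed.

End Rounds.

(** * Number of separators and colourings against the decay *)

Section ProductBound.
Variable R : realType.

(** [card_small_sets] at density [d ^ -2]. The crude [d <= expR d] suffices, since [d * m] is at
    most [2 ^ d / d ^ 2]. *)
Lemma small_sets_expR d m : (2 <= d)%N -> (m * d ^ 3 <= 2 ^ d)%N ->
  #|[set U : {set hvert d} | (#|U| <= m)%N]|%:R <= expR (4 * 2 ^+ d / d%:R ^+ 2) :> R.
Proof.
move=> d2 md; have dR : 2 <= d%:R :> R by rewrite (ler_nat _ 2).
have d0 : 0 < d%:R :> R by lra.
set x : R := (d%:R ^+ 2)^-1.
have x0 : 0 < x by rewrite invr_gt0 exprn_gt0.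
have x4 : x <= 1 / 4.
  by rewrite /x -[_^-1]mul1r ler_pdivrMr ?exprn_gt0 //; nra.
have x1 : x <= 1 by lra.
have x01 : 0 <= x <= 1 by rewrite ltW.
have hm : expR (- (2 * d%:R * m%:R)) <= x ^+ m.
  have -> : - (2 * d%:R * m%:R) = m%:R * (- (2 * d%:R)) :> R by ring.
  rewrite expRM_natl lerXn2r ?nnegrE ?expR_ge0 ?(ltW x0) //.
  rewrite expRN /x lef_pV2 ?posrE ?expR_gt0 ?exprn_gt0 //.
  rewrite expRM_natl lerXn2r ?nnegrE ?expR_ge0 ?(ltW d0) //.
  by apply: le_trans (expR_ge1Dx _); lra.
have hn : expR (- (2 * x * 2 ^+ d)) <= (1 - x) ^+ #|{: hvert d}|.
  rewrite card_hvert -natrX.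
  have -> : - (2 * x * (2 ^ d)%:R) = (2 ^ d)%:R * (- (2 * x)) :> R by ring.
  have x1' : 0 < 1 - x by lra.
  rewrite expRM_natl; apply: lerXn2r; rewrite ?nnegrE ?expR_ge0 ?ltW //.
  rewrite expRN -[X in _ < X]invrK ltf_pV2 ?posrE ?expR_gt0 ?invr_gt0 //.
  apply: lt_le_trans (expR_ge1Dx _).
  by rewrite -[_^-1]mul1r ltr_pdivrMr //; nra.
have e : 4 * 2 ^+ d * x = 2 * x * 2 ^+ d + 2 * x * 2 ^+ d by ring.
have mx : d%:R * m%:R <= x * 2 ^+ d.
  rewrite [x * _]mulrC ler_pdivlMr ?exprn_gt0 // -!natrX -!natrM ler_nat.
  apply: leq_trans md; rewrite -mulnA [(d ^ 3)%N]expnS; lia.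
have h0 := card_small_sets (hvert d) m x01.
have h : #|[set U : {set hvert d} | (#|U| <= m)%N]|%:R <=
    expR (2 * d%:R * m%:R + 2 * x * 2 ^+ d) :> R.
  rewrite -[X in _ <= X]invrK -expRN opprD expRD -[_^-1]mul1r.
  rewrite ler_pdivlMr ?mulr_gt0 ?expR_gt0 //; apply: le_trans h0.
  by rewrite ler_wpM2l //; apply: ler_pM; rewrite ?expR_ge0 //; exact: hn.
apply: (le_trans h); rewrite ler_expR e lerD2r -mulrA -[X in _ <= X]mulrA.
by rewrite ler_wpM2l.
Qed.

(** In units of [c6 * 2 ^ d / d], separators and colourings cost 1/4 each and the crossings gain 1.
    The 2 in [c6] pays for rounding down [2 ^ d / C]. *)
Lemma failure_product d m C Ck (gam : R) : (2 <= d)%N -> (m * d ^ 3 <= 2 ^ d)%N ->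
  (0 < C)%N -> (2 * C <= 2 ^ d)%N -> 0 < gam <= d%:R -> (0 < Ck)%N ->
  let c6 := gam / (2 * C%:R) in 4 / c6 <= Ck%:R -> 16 / c6 <= d%:R ->
  #|[set U : {set hvert d} | (#|U| <= m)%N]|%:R * 2 ^+ (2 ^ d %/ (Ck * d)) *
    (1 - gam / d%:R) ^+ (2 ^ d %/ C) <= expR (- (c6 / 2 * (2 ^+ d / d%:R))).
Proof.
move=> d2 md C0 C2 /andP[gam0 gamd] Ck0 c6 hCk hd.
have dR : 2 <= d%:R :> R by rewrite (ler_nat _ 2).
have d0 : 0 < d%:R :> R by lra.
have CR : 0 < C%:R :> R by rewrite ltr0n.
have CkR : 0 < Ck%:R :> R by rewrite ltr0n.
have c60 : 0 < c6 by rewrite divr_gt0 // mulr_gt0.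
set y : R := 2 ^+ d / d%:R; have y0 : 0 < y by rewrite divr_gt0 // exprn_gt0.
have h1 : #|[set U : {set hvert d} | (#|U| <= m)%N]|%:R <= expR (c6 / 4 * y).
  apply: le_trans (small_sets_expR d2 md) _; rewrite ler_expR.
  have -> : 4 * 2 ^+ d / d%:R ^+ 2 = 4 * y / d%:R by rewrite /y; field; lra.
  rewrite ler_pdivrMr //; move: hd; rewrite ler_pdivrMr // => hd.
  have : y * 16 <= y * (d%:R * c6) by rewrite ler_wpM2l // ltW.
  lra.
have h2 : 2 ^+ (2 ^ d %/ (Ck * d)) <= expR (c6 / 4 * y).
  set j := (_ %/ _)%N; have hj : j%:R * (Ck%:R * d%:R) <= 2 ^+ d :> R.
    by rewrite -natrX -!natrM ler_nat leq_divM.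
  apply: (@le_trans _ _ (expR j%:R)).
    rewrite -[X in expR X]mulr1 expRM_natl lerXn2r ?nnegrE ?expR_ge0 //.
    by apply: le_trans (expR_ge1Dx _); lra.
  rewrite ler_expR.
  have {}hj : j%:R * Ck%:R <= y by rewrite /y ler_pdivlMr // -mulrA.
  move: hCk; rewrite ler_pdivrMr // => hCk.
  have : j%:R * 4 <= j%:R * (Ck%:R * c6) by rewrite ler_wpM2l.
  have : j%:R * Ck%:R * c6 <= y * c6 by rewrite ler_wpM2r // ltW.
  lra.
have h3 : (1 - gam / d%:R) ^+ (2 ^ d %/ C) <= expR (- (c6 * y)).
  set j := (_ %/ _)%N; have hj : 2 ^+ d <= 2 * C%:R * j%:R :> R.
    have hlt : (2 ^ d < j.+1 * C)%N by rewrite ltn_ceil.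
    have : (2 ^ d <= 2 * C * j)%N.
      move: hlt C2; rewrite mulSn -mulnA [(C * j)%N]mulnC.
      by move: (j * C)%N (2 ^ d)%N => u v; clear; lia.
    by rewrite -(ler_nat R) natrX !natrM.
  apply: (@le_trans _ _ (expR (- (gam / d%:R)) ^+ j)).
    rewrite lerXn2r ?nnegrE ?expR_ge0 ?subr_ge0 ?ler_pdivrMr ?mul1r //.
    exact: expR_ge1Dx.
  rewrite -expRM_natl ler_expR mulrN lerN2 /c6 /y.
  have -> : gam / (2 * C%:R) * (2 ^+ d / d%:R) = 2 ^+ d / (2 * C%:R) * (gam / d%:R).
    by field; lra.
  rewrite ler_wpM2r //; first by rewrite divr_ge0 // ltW.
  by rewrite ler_pdivrMr ?mulr_gt0 // mulrC.
have -> : - (c6 / 2 * y) = c6 / 4 * y + c6 / 4 * y + - (c6 * y) by lra.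
rewrite !expRD; apply: ler_pM => //.
- by rewrite mulr_ge0 // exprn_ge0.
- by rewrite exprn_ge0 // subr_ge0 ler_pdivrMr // mul1r.
by apply: ler_pM => //; rewrite exprn_ge0.
Qed.

Lemma expR_decay (x delta : R) : 0 < delta -> 2 / delta <= x -> expR (- x) <= delta / 2.
Proof.
move=> d0 hx; have x0 : 0 < x by apply: lt_le_trans hx; rewrite divr_gt0.
rewrite expRN; apply: (@le_trans _ _ (x^-1)).
  rewrite lef_pV2 ?posrE ?expR_gt0 //; apply: le_trans (expR_ge1Dx _); lra.
by rewrite -[X in _ <= X]invrK lef_pV2 ?posrE ?invr_gt0 ?divr_gt0 // invf_div.
Qed.

End ProductBound.

Section Asymptotics.
Variables (R : realType) (eps : R).
Hypothesis eps_gt0 : 0 < eps.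

Lemma nat_ge (x : R) : exists n : nat, x <= n%:R.
Proof.
exists (Num.bound `|x|); apply: le_trans (ler_norm x) _.
by apply/ltW/archi_boundP; rewrite normr_ge0.
Qed.

Lemma div_nat_itv01 (d : nat) (c : R) : 0 <= c -> c <= d%:R -> (0 < d)%N -> 0 <= c / d%:R <= 1.
Proof. by move=> c0 cd d0; rewrite divr_ge0 //= ler_pdivrMr ?ltr0n // mul1r. Qed.

(** [a] comes before [Ck], because [haven_likely] picks [Ck] in terms of [a]. Any [Ck] is allowed,
    as [k] is linear in [d] and [2 ^ k] exceeds [Ck * d] eventually. *)
Lemma sparse_rare : exists2 a : nat, (0 < a)%N & forall (Ck : nat) (delta : R), 0 < delta ->
  exists D : nat, forall d : nat, (D <= d)%N ->
  EX ((1 + eps / 3) / d%:R) (hedges d) (fun G =>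
    (2 ^ d < d ^ 2 * #|sparse (Ck * d) (4 * (d %/ a)) G|)%N%:R) <= delta.
Proof.
have e0 := eps_gt0. have e6 : 0 < 1 + eps / 6 by lra.
have [rho [rho0 rho1 rhoE]] : exists rho : R, [/\ 0 < rho, rho < 1 & rho * (1 + eps / 6) = 1].
  exists (1 + eps / 6)^-1; rewrite invr_gt0 mulVf ?gt_eqF //; split=> //.
  by rewrite -[_^-1]mul1r ltr_pdivrMr //; lra.
have [H0 hH0] := nat_ge ((1 + eps / 3) * 6 / eps); set H := H0.+1.
have hH : (1 + eps / 3) * 6 / eps <= H%:R by apply: le_trans hH0 _; rewrite ler_nat.
(* 32 is [2 ^ 4 * 2]: the threshold [4 * t] costs [2 ^ 4] per unit of [t], and a factor 1/2 must
   survive. *)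
have [|B0 hB0] := @geometric_small R ((1 - rho) / 2) 32; first by lra.
set tau := 1 - (1 - rho) / 2 in hB0.
have tauE : (1 + rho) / 2 = tau by rewrite /tau; field.
have tau01 : 0 <= tau <= 1 by rewrite /tau; lra.
set B := B0.+1.
have hB : 2 ^+ 4 * tau ^+ B <= 2^-1.
  have : tau ^+ B <= tau ^+ B0 by case/andP: tau01 => h1 h2; apply: ler_wiXn2l.
  by move: hB0; move: (tau ^+ B) (tau ^+ B0) => u v; lra.
exists (2 * H * B)%N; first by rewrite muln_gt0 muln_gt0.
set a := (2 * H * B)%N; have a0 : (0 < a)%N by rewrite muln_gt0 muln_gt0.
move=> Ck delta delta0.
have H40 : (0 < 4 * H)%N by [].
have [D1 hD1] := poly_leq_exp2 1 Ck H40.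
have [M1 hM1] := nat_ge delta^-1.
have [D2 hD2] := poly_leq_exp2 2 M1 a0.
have [D3 hD3] := nat_ge (1 + eps / 3).
exists (D1 + D2 + D3 + 1)%N => d hd.
have [dD1 dD2 dD3 d0] : [/\ D1 <= d, D2 <= d, D3 <= d & 0 < d]%N.
  by split; move: hd; clear; lia.
have {}hD1 := hD1 d dD1; have {}hD2 := hD2 d dD2.
have d0R : 0 < d%:R :> R by rewrite ltr0n.
have p01 : 0 <= (1 + eps / 3) / d%:R <= 1.
  apply: div_nat_itv01 => //; first by lra.
  by apply: le_trans hD3 _; rewrite ler_nat.
(* The [b] trial coordinates and the loss [2 * k] take at most [d / H] together, so the mean
   offspring stays above [1 + eps / 6], which is [1 / rho]. *)
set t := (d %/ a)%N; set k := (d %/ (4 * H))%N; set b := (B * t)%N.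
have hb : (H * (b + 2 * k) <= d)%N.
  have h1 : (a * t <= d)%N by rewrite mulnC leq_divM.
  have h2 : (4 * H * k <= d)%N by rewrite mulnC leq_divM.
  have e1 : (2 * (H * b) = a * t)%N by rewrite /a /b; ring.
  have e2 : (4 * H * k = 2 * (H * (2 * k)))%N by ring.
  by rewrite mulnDr; move: h1 h2; rewrite -e1 e2; clear; lia.
have hb' : (b + 2 * k <= d)%N by apply: leq_trans hb; rewrite leq_pmull.
pose N := (d - (b + 2 * k))%N.
have hN : (N + 2 * k + b <= d)%N by rewrite /N; move: hb'; clear; lia.
have grow : 1 <= rho * (N%:R * ((1 + eps / 3) / d%:R)).
  suff : 1 + eps / 6 <= N%:R * ((1 + eps / 3) / d%:R).
    by move=> h; rewrite -[X in X <= _]rhoE ler_wpM2l // ltW.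
  rewrite mulrA ler_pdivlMr //.
  have : H%:R * (b + 2 * k)%:R <= d%:R :> R by rewrite -natrM ler_nat.
  rewrite /N natrB //; have := ler0n R (b + 2 * k); move: (b + 2 * k)%:R => c c0 hc.
  have : (1 + eps / 3) * 6 * c <= eps * d%:R.
    apply: (@le_trans _ _ (H%:R * eps * c)).
      by rewrite ler_wpM2r // -ler_pdivrMr.
    by rewrite mulrAC [_ * eps]mulrC ler_wpM2l // ltW.
  lra.
have leK : (Ck * d <= 2 ^ k)%N by move: hD1; rewrite expn1.
apply: le_trans (many_sparse_prob _ p01 _ leK grow hN) _; first by rewrite rho0 ltW.
rewrite tauE /b 2!exprM -exprMn.
apply: (@le_trans _ _ (d%:R ^+ 2 * (2^-1) ^+ t)).
  rewrite ler_wpM2l ?exprn_ge0 // lerXn2r ?nnegrE ?invr_ge0 //.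
  by case/andP: tau01 => h1 _; rewrite mulr_ge0 ?exprn_ge0.
rewrite exprVn ler_pdivrMr ?exprn_gt0 //.
have h2 : M1%:R * d%:R ^+ 2 <= 2 ^+ t :> R.
  by rewrite -!natrX -natrM ler_nat.
apply: le_trans (ler_wpM2l (ltW delta0) h2); rewrite mulrA ler_peMl ?exprn_ge0 //.
by move: hM1; rewrite -[delta^-1]mul1r ler_pdivrMr // mulrC.
Qed.

Lemma one_sub_sqr_mono (q r : R) : 0 <= q <= r -> r < 1 ->
  0 <= 1 - (1 - q) ^+ 2 <= 1 - (1 - r) ^+ 2.
Proof.
move=> /andP[q0 qr] r1; rewrite subr_ge0 exprn_ile1 ?subr_ge0 ?gerBl //=; last first.
  exact: le_trans qr (ltW r1).
by rewrite lerD2l lerN2 lerXn2r ?nnegrE ?subr_ge0 ?lerD2l ?lerN2 ?(le_trans qr) // ltW.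
Qed.

Definition separator_bound (a Ck d : nat) : nat :=
  (2 ^ d %/ (256 * a ^ 2 * (1 + 3 * a * Ck) * d ^ 3))%N.

Lemma haven_likely (a : nat) : (0 < a)%N ->
  exists2 Ck : nat, (0 < Ck)%N & forall delta : R, 0 < delta ->
  exists D : nat, forall d : nat, (D <= d)%N ->
  forall G1 : {set {set hvert d}}, G1 \subset hedges d ->
  (d ^ 2 * #|sparse (Ck * d) (4 * (d %/ a)) G1| <= 2 ^ d)%N ->
  EX (eps / 3 / d%:R) (hedges d) (fun G2 => EX (eps / 3 / d%:R) (hedges d) (fun G3 =>
    (~~ haven_holds (G1 :|: G2 :|: G3) (large G1 (Ck * d)) (separator_bound a Ck d))%:R)) <= delta.
Proof.
have e0 := eps_gt0; move=> a0; have a0R : 0 < a%:R :> R by rewrite ltr0n.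
have [c2 c2E] : exists c2 : R, c2 = eps / 3 by exists (eps / 3).
have c20 : 0 < c2 by rewrite c2E; lra.
(* Bounds free of [d]: [y] from below for [t * p], then [r] from above for the probability that [t]
   given spokes are all closed, and [z] for the failure of at least one of two ends. *)
have [y [y0 yE]] : exists y : R, 0 < y /\ y * (2 * a%:R) = c2.
  by exists (c2 / (2 * a%:R)); rewrite divr_gt0 ?mulr_gt0 // divfK // mulf_neq0 ?gt_eqF.
have [r [r0 r1 rE]] : exists r : R, [/\ 0 < r, r < 1 & r = (1 + y)^-1].
  exists (1 + y)^-1; split=> //; first by rewrite invr_gt0; lra.
  by rewrite -[_^-1]mul1r ltr_pdivrMr; lra.
have [z [z0 z1 zE]] : exists z : R, [/\ 0 <= z, z < 1 & z = 1 - (1 - r) ^+ 2].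
  exists (1 - (1 - r) ^+ 2); split=> //; last by rewrite gtrBl exprn_gt0 // subr_gt0.
  by rewrite subr_ge0 exprn_ile1 ?subr_ge0 ?gerBl // ltW.
(* The requirements of [matching_step]; since [d * p] is the constant [c2], one [s] serves every
   [d]. *)
have [s [s0 s1 sz sc]] : exists s : R, [/\ 0 < s, s < 1, s <= (1 - z) / 2 &
    2 * s * c2 <= (1 - z) / (1 + z)].
  have u0 : 0 < (1 - z) / 2 by lra.
  have v0 : 0 < (1 - z) / (1 + z) / (2 * c2) by rewrite !divr_gt0 //; lra.
  exists (Num.min ((1 - z) / 2) ((1 - z) / (1 + z) / (2 * c2))); split.
  - by rewrite lt_min u0 v0.
  - by rewrite gt_min; apply/orP; left; lra.
  - by rewrite ge_min lexx.
  - rewrite mulrAC mulrC -ler_pdivlMr ?mulr_gt0 //.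
    by rewrite ge_min lexx orbT.
pose gam := s * c2; have gam0 : 0 < gam by rewrite mulr_gt0.
pose C := (128 * a ^ 2)%N; have C0 : (0 < C)%N by rewrite muln_gt0 expn_gt0 a0.
pose c6 : R := gam / (2 * C%:R).
have c60 : 0 < c6 by rewrite divr_gt0 // mulr_gt0 // ltr0n.
have [Ck0 hCk0] := nat_ge (4 / c6).
exists Ck0.+1 => // delta delta0; set Ck := Ck0.+1.
have hCk : 4 / c6 <= Ck%:R by apply: le_trans hCk0 _; rewrite ler_nat.
have [D1 hD1] := nat_ge (16 / c6).
have [D2 hD2] := nat_ge c2.
have [D3 hD3] := poly_leq_exp2 0 (2 * C) (isT : (0 < 1)%N).
have [M hM] := nat_ge (4 / (c6 * delta)).
have [D4 hD4] := poly_leq_exp2 1 M (isT : (0 < 1)%N).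
exists (D1 + D2 + D3 + D4 + 256 * a ^ 2)%N => d hd G1 G1E few.
have [dD1 dD2 dD3] : [/\ D1 <= d, D2 <= d & D3 <= d]%N.
  by split; move: hd; clear; lia.
have [dD4 da] : (D4 <= d /\ 256 * a ^ 2 <= d)%N.
  by split; move: hd; clear; lia.
have a20 : (a <= a ^ 2)%N by rewrite -{1}(expn1 a) leq_pexp2l.
have d2 : (2 <= d)%N by move: da a20 a0; clear; lia.
have d0 : (0 < d)%N by exact: ltnW.
have d0R : 0 < d%:R :> R by rewrite ltr0n.
have ad : (a <= d)%N by move: da a20; clear; lia.
set t := (d %/ a)%N in few *.
have t0 : (0 < t)%N by rewrite divn_gt0.
have dt : (d <= 2 * a * t)%N.
  have h : (d < t.+1 * a)%N by rewrite ltn_ceil.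
  have h' : (t.+1 * a <= 2 * t * a)%N by rewrite leq_mul2r; apply/orP; right; move: t0; clear; lia.
  by move: (leq_trans (ltnW h) h'); rewrite -mulnA [(t * a)%N]mulnC mulnA.
have {}hD1 : 16 / c6 <= d%:R by apply: le_trans hD1 _; rewrite ler_nat.
have {}hD2 : c2 <= d%:R by apply: le_trans hD2 _; rewrite ler_nat.
rewrite -c2E; set p := c2 / d%:R.
have p01 : 0 <= p <= 1 by apply: div_nat_itv01 => //; apply: ltW.
have p0 : 0 < p by rewrite divr_gt0.
have dp : d%:R * p = c2 by rewrite mulrC divfK // gt_eqF.
have tp : y <= t%:R * p.
  have : y * d%:R <= y * (2 * a%:R * t%:R).
    by rewrite ler_wpM2l ?(ltW y0) // -!natrM ler_nat.
  by rewrite mulrA yE mulrA ler_pdivlMr // [t%:R * _]mulrC.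
have rt : (1 - p) ^+ t <= r.
  apply: le_trans (pow_one_sub_le t p01) _.
  have h1 : 0 < 1 + y by lra.
  have h2 : 0 < 1 + t%:R * p by lra.
  by rewrite rE lef_pV2 ?posrE // lerD2l.
have rt0 : 0 <= (1 - p) ^+ t by rewrite exprn_ge0 // subr_ge0; case/andP: p01.
have w0z : 0 <= 1 - (1 - (1 - p) ^+ t) ^+ 2 <= z.
  by rewrite zE; apply: one_sub_sqr_mono; rewrite ?rt0.
have gamE : s * p = gam / d%:R by rewrite mulrA.
have sp1 : s * p < 1.
  case/andP: p01 => _ p1; apply: le_lt_trans s1; rewrite -[X in _ <= X]mulr1.
  by rewrite ler_wpM2l // ltW.
have sp0 : 0 < s * p by rewrite mulr_gt0.
have step : (1 - p) / (1 - s * p) + p * (1 - (1 - (1 - p) ^+ t) ^+ 2) / (1 - s * p) ^+ (2 * d) <= 1.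
  apply: (matching_step _ w0z z1 _ s1 sz).
  - by case/andP: p01 => _ ->; rewrite p0.
  - by rewrite s0 ltW.
  - by rewrite dp.
have g01 : 0 < 1 - s * p <= 1 by rewrite subr_gt0 sp1 gerBl ltW.
have md : (separator_bound a Ck d * (256 * a ^ 2 * (1 + 3 * a * Ck) * d ^ 3) <= 2 ^ d)%N.
  exact: leq_divM.
apply: le_trans (haven_failure_le G1E p01 g01 step _ a0 t0 dt da md few) _ => //.
rewrite gamE -/C.
have md' : (separator_bound a Ck d * d ^ 3 <= 2 ^ d)%N.
  apply: leq_trans md; rewrite leq_mul2l; apply/orP; right.
  by rewrite leq_pmull // !muln_gt0 a0.
have gamd : 0 < gam <= d%:R.
  rewrite gam0; apply: le_trans hD2; rewrite -[X in _ <= X]mul1r.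
  by rewrite ler_wpM2r // ltW.
have C2 : (2 * C <= 2 ^ d)%N by have := hD3 d dD3; rewrite muln1 divn1.
apply: le_trans (failure_product d2 md' C0 C2 gamd _ hCk hD1) _ => //.
apply: (@le_trans _ _ (delta / 2)); last by lra.
apply: expR_decay => //; rewrite -/c6.
have hM2 : M%:R <= 2 ^+ d / d%:R :> R.
  rewrite ler_pdivlMr // -natrX -natrM ler_nat; have := hD4 d dD4.
  by rewrite expn1 divn1.
have h4 : 4 / (c6 * delta) <= 2 ^+ d / d%:R by apply: le_trans hM hM2.
have -> : 2 / delta = c6 / 2 * (4 / (c6 * delta)) by field; rewrite !gt_eqF.
by rewrite ler_wpM2l // divr_ge0 // ltW.
Qed.

End Asymptotics.

(** * Assembling the three rounds *)

Lemma hprobE (R : realType) d (p : R) (P : {set {set hvert d}} -> Prop) :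
  hprob p P = EX p (hedges d) (fun G => `[< P G >]%:R).
Proof.
rewrite /hprob /EX big_mkcondr; apply: eq_bigr => G _.
by case: `[< _ >]; rewrite ?mulr1 ?mulr0.
Qed.

Theorem theorem1p2 (R : realType) (eps : R) (heps : 0 < eps) :
  exists c : R, 0 < c /\
  forall delta : R, 0 < delta ->
  exists D : nat, forall d : nat, (D <= d)%N ->
    1 - delta <=
    hprob ((1 + eps) / d%:R)
      (d := d) (fun G => has_cycle_ge G
         (c * (2 ^+ d / ((d%:R) ^+ 3 * (ln (d%:R : R)) ^+ 3)))).
Proof.
have [a a0 rare] := sparse_rare heps.
have [Ck Ck0 likely] := haven_likely heps a0.
pose M0 := (256 * a ^ 2 * (1 + 3 * a * Ck))%N.
have M00 : (0 < M0)%N by rewrite !muln_gt0 a0.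
have M0R : 0 < M0%:R :> R by rewrite ltr0n.
exists M0%:R^-1; split; first by rewrite invr_gt0.
move=> delta delta0; have delta2 : 0 < delta / 2 by lra.
have [D1 hD1] := rare Ck _ delta2.
have [D2 hD2] := likely _ delta2.
have [D3 hD3] := nat_ge (1 + eps).
have [D4 hD4] := poly_leq_exp2 3 (2 * M0) (isT : (0 < 1)%N).
have [D5 hD5] := nat_ge (expR 1 : R).
exists (D1 + D2 + D3 + D4 + D5 + 1)%N => d hd.
have [dD1 dD2 dD3] : [/\ D1 <= d, D2 <= d & D3 <= d]%N by split; move: hd; clear; lia.
have [dD4 dD5 d0] : [/\ D4 <= d, D5 <= d & 0 < d]%N by split; move: hd; clear; lia.
have d0R : 0 < d%:R :> R by rewrite ltr0n.
have {}hD3 : 1 + eps <= d%:R by apply: le_trans hD3 _; rewrite ler_nat.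
have {}hD5 : expR 1 <= d%:R :> R by apply: le_trans hD5 _; rewrite ler_nat.
have {}hD4 : (2 * M0 * d ^ 3 <= 2 ^ d)%N by have := hD4 d dD4; rewrite divn1.
have {}hD1 := hD1 d dD1.
have {}hD2 := hD2 d dD2.
set m := separator_bound a Ck d in hD2.
have M0d0 : (0 < M0 * d ^ 3)%N by rewrite muln_gt0 M00 expn_gt0 d0.
(* This also makes a sequence longer than [m] have the three vertices that a cycle needs. *)
have m1 : (1 < m)%N by rewrite leq_divRL // mulnA.
set L := M0%:R^-1 * _.
(* [ln d] is at least 1 once [d] is at least [e], so [L] is at most [2 ^ d / (M0 * d ^ 3)], whose
   integer part is [m]. *)
have mL : L <= m.+1%:R.
  have lnd : 1 <= ln (d%:R : R) by rewrite -ler_expR lnK // posrE.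
  have h : 2 ^+ d <= m.+1%:R * (M0%:R * d%:R ^+ 3) :> R.
    by rewrite -!natrX -!natrM ler_nat ltnW // ltn_ceil.
  have d30 : 0 < d%:R ^+ 3 :> R by rewrite exprn_gt0.
  have l3 : 1 <= ln (d%:R : R) ^+ 3 by rewrite exprn_ege1.
  have dl : 0 < d%:R ^+ 3 * ln (d%:R : R) ^+ 3.
    by rewrite mulr_gt0 // (lt_le_trans ltr01).
  rewrite /L mulrC ler_pdivrMr // ler_pdivrMr //; apply: (le_trans h).
  rewrite -[X in _ <= X]mulrA ler_wpM2l ?ler0n // ler_wpM2l ?ler0n //.
  by rewrite ler_peMr // ltW.
pose f (G : {set {set hvert d}}) : R := `[< has_cycle_ge G L >]%:R.
have fmono (G H : {set {set hvert d}}) : G \subset H -> f G <= f H.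
  move=> sGH; rewrite /f ler_nat; case: asboolP => // -[s [s3 us cs Ls]].
  case: asboolP => // -[]; exists s; split=> //.
  by apply: sub_cycle cs => x y; apply: (subsetP sGH).
have haven_f G W : haven_holds G W m -> f G = 1.
  move=> /(haven_holds_cycle m1)[s [ms us cs]]; rewrite /f; case: asboolP => // -[].
  exists s; split=> //; first exact: leq_trans ms.
  by apply: le_trans mL _; rewrite ler_nat.
have f01 G : 0 <= f G by rewrite ler0n.
rewrite hprobE -/f.
set E := hedges d; pose p1 : R := (1 + eps / 3) / d%:R; pose p2 : R := eps / 3 / d%:R.
have p101 : 0 <= p1 <= 1 by apply: div_nat_itv01 => //; lra.
have p201 : 0 <= p2 <= 1 by apply: div_nat_itv01 => //; lra.
(* Density of the union of the three rounds. It is at most [p1 + p2 + p2 = (1 + eps) / d], and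
   having a long cycle is increasing, so [EX_mono] applies. *)
pose q := 1 - (1 - p1) * (1 - (1 - (1 - p2) * (1 - p2))).
have /andP[p10 p11] := p101; have /andP[p20 p21] := p201.
have qle : q <= (1 + eps) / d%:R.
  have -> : (1 + eps) / d%:R = p1 + p2 + p2 by rewrite /p1 /p2; field; rewrite gt_eqF.
  rewrite /q; move: p1 p2 p10 p11 p20 p21 {p101 p201 hD1 hD2 q} => u v u0 u1 v0 v1.
  have : 0 <= u * v by rewrite mulr_ge0.
  have : 0 <= v * v * (1 - u) by rewrite !mulr_ge0 // subr_ge0.
  lra.
have q0 : 0 <= q.
  rewrite /q subKr subr_ge0; apply: mulr_ile1; rewrite ?subr_ge0 ?gerBl //.
  - by rewrite mulr_ge0 ?subr_ge0.
  - by apply: mulr_ile1; rewrite ?subr_ge0 ?gerBl.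
have pe1 : (1 + eps) / d%:R <= 1 by rewrite ler_pdivrMr // mul1r.
apply: le_trans (EX_mono (p := q) _ pe1 _); last first.
- by move=> G H GH _; apply: fmono.
- by rewrite q0.
rewrite /q EX_sprinkle.
(* The indicator covers the exceptional first rounds, where the left side is negative; averaged over
   [G1] it costs the other [delta / 2]. *)
have bound (G1 : {set {set hvert d}}) : G1 \subset E ->
    1 - delta / 2 - (2 ^ d < d ^ 2 * #|sparse (Ck * d) (4 * (d %/ a)) G1|)%N%:R <=
    EX (1 - (1 - p2) * (1 - p2)) E (fun H => f (G1 :|: H)).
  move=> G1E; rewrite EX_sprinkle; case: ltnP => few /=.
    apply: (@le_trans _ _ 0); first by lra.
    by apply: EX_ge0 => // G2 _; apply: EX_ge0.
  have := hD2 G1 G1E few; rewrite -/p2 -/E => hv.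
  rewrite subr0; set B := EX p2 E _ in hv; set A := EX p2 E _.
  suff : 1 <= A + B by move: hv; move: A B; clear; move=> A B; lra.
  rewrite {}/A {hv}/B.
  rewrite -EXD -[X in X <= _](EX_cst p2 E); apply: le_EX => // G2 _.
  rewrite -EXD -[X in X <= _](EX_cst p2 E); apply: le_EX => // G3 _.
  rewrite setUA; case hh: (haven_holds _ _ _); last by rewrite lerDr.
  by rewrite (haven_f _ _ hh) addr0.
apply: (@le_trans _ _ (EX p1 E (fun G1 => 1 - delta / 2 +
    -1 * (2 ^ d < d ^ 2 * #|sparse (Ck * d) (4 * (d %/ a)) G1|)%N%:R))).
  rewrite EXD EX_cst EXZ; move: hD1; rewrite -/p1 -/E; lra.
by apply: le_EX => // G1 G1E; rewrite mulN1r; apply: bound.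
Qed.
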